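(* There are no space-like biconservative PMCV surfaces in $\mathbb E^1_1\times \mathbb H^4$.
   Context: $\mathbb E^1_1\times\mathbb H^4$ is $\mathbb R\times \mathbb H^4$ with the Lorentzian product metric $\langle\cdot,\cdot\rangle=-dt^2+g_{\mathbb H^4}$, where $\mathbb H^4$ has constant curvature $-1$. $\widetilde\nabla$ is its Levi-Civita connection and $\widetilde R(X,Y)Z=\widetilde\nabla_X\widetilde\nabla_YZ-\widetilde\nabla_Y\widetilde\nabla_XZ-\widetilde\nabla_{[X,Y]}Z$. Let $M$ be a space-like surface (isometrically immersed by $\phi$, with positive definite induced metric), with second fundamental form $h$, shape operators $A$, normal connection $\nabla^\perp$ and mean curvature vector $H=\frac12\mathrm{tr}\,h$. $M$ is PMCV if $\nabla^\perp H=0$. $M$ is biconservative if the tangential part of the bitension field $\tau_2(\phi)=\Delta\tau(\phi)-\mathrm{tr}\,\widetilde R(d\phi,\tau(\phi))d\phi$ vanishes, where $\tau(\phi)=\mathrm{tr}\,\nabla d\phi=2H$ and $\Delta$ is the rough Laplacian; equivalently $2\nabla\|H\|^2+4\,\mathrm{tr}\,A_{\nabla^\perp_\cdot H}(\cdot)+4\,\mathrm{tr}(\widetilde R(\cdot,H)\cdot)^T=0$. Standing assumptions on all surfaces considered: writing $\frac{\partial}{\partial t}|_M=T+\eta$ with $T$ tangent and $\eta$ normal to $M$, $T$ vanishes nowhere on $M$; surfaces are connected and oriented, all objects are smooth; $H\neq0$. *)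

(* Defs.v *)
(* MathComp-Analysis, over an arbitrary R : realType.

   A vector of R^n, in particular a tangent vector in coordinates, is a row
   vector 'rV[R]_n whose a-th coordinate is [v 0 a].  A pseudo-Riemannian
   metric on an open subset of R^n is the map sending a point to its Gram
   matrix in the coordinate frame. *)
From mathcomp Require Import all_boot all_order all_algebra.
From mathcomp Require Import all_classical all_reals all_analysis.
Set Implicit Arguments.
Unset Strict Implicit.
Unset Printing Implicit Defensive.
Import Order.TTheory GRing.Theory Num.Theory.
Import numFieldNormedType.Exports.
Local Open Scope classical_set_scope.
Local Open Scope ring_scope.

Section Calculus.
Context {R : realType}.

Definition basis_vec {n} (i : 'I_n) : 'rV[R]_n := delta_mx 0 i.

Definition pderiv {n} (i : 'I_n) (f : 'rV[R]_n -> R) (x : 'rV[R]_n) : R :=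
  'D_(basis_vec i) f x.

Definition vpderiv {n m} (i : 'I_n) (f : 'rV[R]_n -> 'rV[R]_m)
    (x : 'rV[R]_n) : 'rV[R]_m :=
  \row_a pderiv i (fun z => f z 0 a) x.

(* [Ck k U f] is the usual "f is of class C^k on U" when U is open. *)
Fixpoint Ck {n} (k : nat) (U : set 'rV[R]_n) (f : 'rV[R]_n -> R) : Prop :=
  if k is k'.+1 then
    (forall x, U x -> differentiable f x) /\ (forall i, Ck k' U (pderiv i f))
  else forall x, U x -> {for x, continuous f}.

Definition smooth_on {n m} (U : set 'rV[R]_n) (f : 'rV[R]_n -> 'rV[R]_m) :=
  forall (a : 'I_m) (k : nat), Ck k U (fun x => f x 0 a).

End Calculus.

(* The covering, Hausdorff and countability axioms make M a smooth surface;
   the positivity of the Jacobians makes the atlas an orientation. *)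
Record oriented_surface_atlas (R : realType) (M : topologicalType) := {
  chart_index : Type;
  chart_dom : chart_index -> set M;
  chart_img : chart_index -> set 'rV[R]_2;
  chart : chart_index -> M -> 'rV[R]_2;
  param : chart_index -> 'rV[R]_2 -> M;
  chart_dom_open : forall i, open (chart_dom i);
  chart_img_open : forall i, open (chart_img i);
  chart_maps : forall i p, chart_dom i p -> chart_img i (chart i p);
  param_maps : forall i u, chart_img i u -> chart_dom i (param i u);
  chartK : forall i p, chart_dom i p -> param i (chart i p) = p;
  paramK : forall i u, chart_img i u -> chart i (param i u) = u;
  chart_continuous :
    forall i p, chart_dom i p -> {for p, continuous (chart i)};
  param_continuous :
    forall i u, chart_img i u -> {for u, continuous (param i)};
  chart_cover : forall p, exists i, chart_dom i p;
  transition_smooth : forall i j,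
    smooth_on (chart_img i `&` (param i @^-1` chart_dom j))
              (chart j \o param i);
  transition_oriented : forall i j u,
    chart_img i u -> chart_dom j (param i u) ->
    0 < \det ('J (chart j \o param i) u);
  atlas_hausdorff : hausdorff_space M;
  atlas_second_countable : @second_countable M
}.

Section LeviCivita.
Context {R : realType} {n : nat} (g : 'rV[R]_n -> 'M[R]_n).

Definition inner (x v w : 'rV[R]_n) : R := (v *m g x *m w^T) 0 0.

(* Christoffel symbol with upper index a and lower indices b, c. *)
Definition christoffel (x : 'rV[R]_n) (a b c : 'I_n) : R :=
  2^-1 * \sum_d invmx (g x) a d *
    (pderiv b (fun z => g z d c) x + pderiv c (fun z => g z b d) x
     - pderiv d (fun z => g z b c) x).

Definition christoffel_vec (x v w : 'rV[R]_n) : 'rV[R]_n :=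
  \row_a \sum_b \sum_c christoffel x a b c * v 0 b * w 0 c.

(* [nabla X Y] is the covariant derivative of Y in the direction X. *)
Definition nabla (X Y : 'rV[R]_n -> 'rV[R]_n) (x : 'rV[R]_n) : 'rV[R]_n :=
  (\row_a 'D_(X x) (fun z => Y z 0 a) x) + christoffel_vec x (X x) (Y x).

(* R(v, w)z at x.  By tensoriality v, w, z may be extended to fields with
   constant coefficients; the bracket of two such fields is 0, so the term
   in [v, w] is absent. *)
Definition curvature (x v w z : 'rV[R]_n) : 'rV[R]_n :=
  nabla (cst v) (nabla (cst w) (cst z)) x
  - nabla (cst w) (nabla (cst v) (cst z)) x.

End LeviCivita.

Section SurfaceInCoordinates.
(* f is the immersion read in a chart of the surface; vector fields along f
   are functions 'rV[R]_2 -> 'rV[R]_n. *)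
Context {R : realType} {n : nat} (g : 'rV[R]_n -> 'M[R]_n).
Variable f : 'rV[R]_2 -> 'rV[R]_n.
Implicit Types (u : 'rV[R]_2) (v : 'rV[R]_n) (V : 'rV[R]_2 -> 'rV[R]_n).

Definition frame (i : 'I_2) u : 'rV[R]_n := vpderiv i f u.

Definition first_form u : 'M[R]_2 :=
  \matrix_(i, j) inner g (f u) (frame i u) (frame j u).

Definition spacelike_at u :=
  forall w : 'rV[R]_2, w != 0 -> 0 < inner first_form u w w.

Definition trace2 u (B : 'I_2 -> 'I_2 -> 'rV[R]_n) : 'rV[R]_n :=
  \sum_i \sum_j invmx (first_form u) i j *: B i j.

Definition tangent_part u v : 'rV[R]_n :=
  trace2 u (fun i j => inner g (f u) v (frame i u) *: frame j u).

Definition normal_part u v : 'rV[R]_n := v - tangent_part u v.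

(* The pullback connection: covariant derivative along f in the direction
   of the i-th coordinate field of the surface. *)
Definition covd (i : 'I_2) V u : 'rV[R]_n :=
  vpderiv i V u + christoffel_vec g (f u) (frame i u) (V u).

Definition second_form u (i j : 'I_2) : 'rV[R]_n :=
  normal_part u (covd i (frame j) u).

Definition mean_curvature u : 'rV[R]_n :=
  2^-1 *: trace2 u (second_form u).

Definition normal_covd (i : 'I_2) V u : 'rV[R]_n :=
  normal_part u (covd i V u).

Definition hessian u (i j : 'I_2) : 'rV[R]_n :=
  covd i (frame j) u
  - \sum_k christoffel first_form u k i j *: frame k u.

Definition tension u : 'rV[R]_n := trace2 u (hessian u).

(* Sign convention: the trace of the second covariant derivative. *)
Definition rough_laplacian V u : 'rV[R]_n :=
  trace2 u (fun i j =>
    covd i (covd j V) u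
    - \sum_k christoffel first_form u k i j *: covd k V u).

Definition bitension u : 'rV[R]_n :=
  rough_laplacian tension u
  - trace2 u (fun i j => curvature g (f u) (frame i u) (tension u) (frame j u)).

End SurfaceInCoordinates.

Section LorentzianProduct.
Context {R : realType}.

(* E^1_1 x H^4 with H^4 in the upper half-space model: the coordinates are
   (t, x1, x2, x3, y) with y > 0 and the metric is
   - dt^2 + (dx1^2 + dx2^2 + dx3^2 + dy^2) / y^2. *)
Definition E11xH4 : set 'rV[R]_5 := [set x | 0 < x 0 ord_max].

Definition metric_E11xH4 (x : 'rV[R]_5) : 'M[R]_5 :=
  diag_mx (\row_a if a == ord0 then -1 else (x 0 ord_max) ^- 2).

Definition d_dt : 'rV[R]_5 := basis_vec ord0.

End LorentzianProduct.

Section SurfacesInE11xH4.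
Context {R : realType} {M : topologicalType} (A : oriented_surface_atlas R M).
Variable phi : M -> 'rV[R]_5.
Local Notation g := metric_E11xH4.

Definition local_expr (i : chart_index A) : 'rV[R]_2 -> 'rV[R]_5 :=
  phi \o param (o := A) i.

Definition in_charts (P : ('rV[R]_2 -> 'rV[R]_5) -> 'rV[R]_2 -> Prop) :=
  forall i u, chart_img (o := A) i u -> P (local_expr i) u.

(* Positive definiteness of the induced metric forces phi to be an
   immersion. *)
Definition spacelike_surface :=
  [/\ forall p, E11xH4 (phi p),
      forall i, smooth_on (chart_img (o := A) i) (local_expr i)
    & in_charts (spacelike_at g)].

(* T vanishes nowhere, T being the tangential part of d/dt. *)
Definition nowhere_zero_T :=
  in_charts (fun f u => tangent_part g f u d_dt != 0).

(* H is not identically zero. *)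
Definition nonzero_mean_curvature :=
  ~ in_charts (fun f u => mean_curvature g f u = 0).

Definition PMCV :=
  in_charts (fun f u =>
    forall i, normal_covd g f i (mean_curvature g f) u = 0).

Definition biconservative :=
  in_charts (fun f u => tangent_part g f u (bitension g f u) = 0).

End SurfacesInE11xH4.

(* Main.v *)
(* The biconservativity equation, for a surface with parallel mean curvature
   vector H, says <H, d/dt> T = 0, so H is horizontal. Then the shape operator
   A_H kills T; its trace 2|H|^2 is constant and nonzero, so with e the unit
   tangent field orthogonal to T and theta = <e, .> one has
   D_X H = - 2|H|^2 theta(X) e. The curvature term in the commutator of D on H
   vanishes, which forces D_X e = theta(X) V with V normal and horizontal; the
   commutator on e and a trace then give
   4|H|^2 = 1 + |T|^2 + |V|^2, while <V, H> = 2|H|^2 gives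
   0 <= |V - 2H|^2 = |V|^2 - 4|H|^2, a contradiction. The argument is local. *)

(* The ambient form is Lorentzian, so a squared length has a known sign only for tangent vectors and
   for horizontal ones, those orthogonal to d/dt. This is why H must be shown horizontal before
   anything else: it makes 2|H|^2 positive and V - 2H space-like. Biconservativity serves only this
   purpose.

   To extract it, consider b(X,Y) = <D_X H, Y>, which is symmetric because D is torsion-free. Its
   divergence is the derivative of its constant trace plus a curvature trace. That trace and the one
   in the bitension field are opposite multiples of <H, d/dt> T on the two sides of the equation, so
   they add up instead of cancelling.

   The identity for 4|H|^2 comes from the form s(X,Y) = <D_X Y, V> - <X,Y> - <X,T><Y,T>. The
   commutator on e says that s(X,Y) = theta(X) s(e,Y), so the trace of s is s(e,e) = |V|^2 - 1;
   computed directly, it is 2<H,V> - 2 - |T|^2.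

   Since H may have zeros, the argument runs on an open set where a chosen coordinate of H does not
   vanish. *)
Require Import Defs.
From mathcomp Require Import all_boot all_order all_algebra.
From mathcomp Require Import all_classical all_reals all_analysis.
From mathcomp Require Import ring lra.
Set Implicit Arguments.
Unset Strict Implicit.
Unset Printing Implicit Defensive.
Import Order.TTheory GRing.Theory Num.Theory.
Import numFieldNormedType.Exports.
Local Open Scope classical_set_scope.
Local Open Scope ring_scope.

(** * Calculus on open subsets of R^n *)

Section MixedPartials.
Context {R : realType} {V : normedModType R}.
Implicit Types (f : V -> R) (x v w : V).

Lemma is_derive_line f x v (s : R) : differentiable f (x + s *: v) ->
  is_derive s 1 (fun r : R => f (x + r *: v)) ('D_v f (x + s *: v)).
Proof.
move=> df.
have E (h : R) : h^-1 *: (f (x + (h *: 1 + s) *: v) - f (x + s *: v)) =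
    h^-1 *: (f (h *: v + (x + s *: v)) - f (x + s *: v)).
  by congr (_ *: (f _ - _)); rewrite scalerDl addrCA [h *: 1]mulr1.
have dfv : derivable f (x + s *: v) v by apply: diff_derivable.
split.
  by rewrite /derivable; under eq_fun do rewrite /= E.
by rewrite /derive; under eq_fun do rewrite /= E.
Qed.

Lemma MVT_line f x v (h : R) : 0 < h ->
  (forall s, 0 <= s <= h -> differentiable f (x + s *: v)) ->
  exists2 s, 0 <= s <= h & f (x + h *: v) - f x = 'D_v f (x + s *: v) * h.
Proof.
move=> h0 df.
have [| |s sI E] := @MVT R (fun r : R => f (x + r *: v))
    (fun r => 'D_v f (x + r *: v)) 0 h h0.
- move=> s sI; apply: is_derive_line; apply: df.
  by move: sI; rewrite in_itv/= => /andP[/ltW-> /ltW->].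
- apply: derivable_within_continuous => s sI.
  apply: (@ex_derive _ _ _ _ _ _ _ (is_derive_line _)).
  by apply: df; move: sI; rewrite in_itv.
exists s; first by move: sI; rewrite in_itv/= => /andP[/ltW-> /ltW->].
by rewrite -[in f x](addr0 x) -(scale0r v) E subr0.
Qed.

(** Two mean value theorems: along v for the increment [phi] of f in the direction w, then along w
    for the derivative of f in the direction v. *)
Lemma second_difference f x v w (h : R) : 0 < h ->
  (forall r s, 0 <= r <= h -> 0 <= s <= h ->
    differentiable f (x + r *: v + s *: w)) ->
  (forall r s, 0 <= r <= h -> 0 <= s <= h ->
    differentiable ('D_v f) (x + r *: v + s *: w)) ->
  exists r s, [/\ 0 <= r <= h, 0 <= s <= h &
    f (x + h *: v + h *: w) - f (x + h *: w) - (f (x + h *: v) - f x) =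
    'D_w ('D_v f) (x + r *: v + s *: w) * h * h].
Proof.
move=> h0 df ddf.
have hh : 0 <= h <= h by apply/andP; split=> //; exact: ltW.
have h00 : 0 <= (0 : R) <= h by apply/andP; split=> //; exact: ltW.
pose phi y := f (y + h *: w) - f y.
have dsh y : differentiable f (y + h *: w) ->
    differentiable (fun z => f (z + h *: w)) y.
  move=> dy; apply: (@differentiable_comp _ _ _ _ (fun z => z + h *: w) f) => //.
have dphi r : 0 <= r <= h -> differentiable phi (x + r *: v).
  move=> rh; apply: differentiableB; first by apply: dsh; apply: df.
  by have := df r 0 rh h00; rewrite scale0r addr0.
have [r rh Er] := MVT_line h0 dphi.
have Dphi : 'D_v phi (x + r *: v) =
    'D_v f (x + r *: v + h *: w) - 'D_v f (x + r *: v).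
  rewrite deriveB; last 2 first.
  - by apply: diff_derivable; apply: dsh; apply: df.
  - by apply: diff_derivable; have := df r 0 rh h00; rewrite scale0r addr0.
  congr (_ - _); rewrite /derive /=.
  by under eq_fun do rewrite -addrA.
have [s sh Es] := @MVT_line ('D_v f) (x + r *: v) w h h0 (fun s sh => ddf r s rh sh).
exists r, s; split => //; rewrite -Es -Dphi -Er /phi.
have swap (p q r0 s0 : R) : p - q - (r0 - s0) = p - r0 - (q - s0) by ring.
by rewrite swap.
Qed.

(** Schwarz's theorem. If the two mixed derivatives differed at x, they would stay apart on a ball
    around x; but a small second difference, read in both orders, equates a value of one with a
    value of the other inside that ball. *)
Lemma derive_comm (U : set V) f x v w : open U -> U x ->
  (forall y, U y -> differentiable f y) ->
  (forall y, U y -> differentiable ('D_v f) y) ->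
  (forall y, U y -> differentiable ('D_w f) y) ->
  {for x, continuous ('D_w ('D_v f))} -> {for x, continuous ('D_v ('D_w f))} ->
  'D_w ('D_v f) x = 'D_v ('D_w f) x.
Proof.
move=> oU Ux df dvf dwf cwv cvw.
apply/eqP; apply: contraT; rewrite -subr_eq0 -normr_gt0 => lt0.
pose e := `|'D_w ('D_v f) x - 'D_v ('D_w f) x| / 2.
have e0 : 0 < e by rewrite divr_gt0.
have : \forall y \near x, U y /\ (`|'D_w ('D_v f) x - 'D_w ('D_v f) y| < e /\
    `|'D_v ('D_w f) x - 'D_v ('D_w f) y| < e).
  apply: filterI; first exact: open_nbhs_nbhs.
  by apply: filterI; [move: cwv => /cvgrPdist_lt/(_ e e0)|
                      move: cvw => /cvgrPdist_lt/(_ e e0)].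
move=> /nbhs_ballP[d /= d0 dB].
(* With h = d / (2c), a point x + r v + s w with r, s at most h lies within hc = d/2 of x. The
   summand 1 keeps c positive when v and w are both zero. *)
pose c := `|v| + `|w| + 1.
have c0 : 0 < c by rewrite ltr_wpDl// addr_ge0.
pose h := d / (2 * c).
have h0 : 0 < h by rewrite divr_gt0// mulr_gt0.
have inB r s : 0 <= r <= h -> 0 <= s <= h -> ball x d (x + r *: v + s *: w).
  move=> /andP[r0 rh] /andP[s0 sh]; rewrite -ball_normE /ball_/=.
  rewrite -addrA opprD addNKr normrN.
  apply: (@le_lt_trans _ _ (h * c)).
    apply: (le_trans (ler_normD _ _)); rewrite !normrZ !ger0_norm// /c !mulrDr.
    rewrite -[leLHS]addr0; apply: lerD; last by rewrite mulr1 ltW.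
    by apply: lerD; apply: ler_wpM2r.
  by rewrite /h invfM mulrA mulfVK ?gt_eqF// gtr_pMr// invf_lt1// ltr1n.
have inB' r s : 0 <= r <= h -> 0 <= s <= h -> ball x d (x + s *: w + r *: v).
  by move=> rh sh; rewrite addrAC; exact: inB.
have [r [s [rh sh E]]] := @second_difference f x v w h h0
  (fun r s rh sh => df _ (dB _ (inB r s rh sh)).1)
  (fun r s rh sh => dvf _ (dB _ (inB r s rh sh)).1).
have [s' [r' [sh' rh' E']]] := @second_difference f x w v h h0
  (fun s r sh rh => df _ (dB _ (inB' r s rh sh)).1)
  (fun s r sh rh => dwf _ (dB _ (inB' r s rh sh)).1).
have EE : 'D_w ('D_v f) (x + r *: v + s *: w) =
          'D_v ('D_w f) (x + s' *: w + r' *: v).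
  apply: (mulIf (lt0r_neq0 h0)); apply: (mulIf (lt0r_neq0 h0)).
  have swap (p q r0 s0 : R) : p - q - (r0 - s0) = p - r0 - (q - s0) by ring.
  apply: etrans (esym E) (etrans _ E').
  by rewrite [x + h *: w + h *: v]addrAC; exact: swap.
have [_ [B1 _]] := dB _ (inB r s rh sh).
have [_ [_ B2]] := dB _ (inB' r' s' rh' sh').
suff : `|'D_w ('D_v f) x - 'D_v ('D_w f) x| < e + e by rewrite -splitr ltxx.
have tri (a b k : R) : `|a - k| < e -> `|b - k| < e -> `|a - b| < e + e.
  move=> ak bk; rewrite -(subrKA k).
  by apply: le_lt_trans (ler_normD _ _) (ltrD ak _); rewrite distrC.
by apply: tri B1 _; rewrite EE.
Qed.

End MixedPartials.

(** * Differentiation rules and stability of smooth functions *)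

Definition smooth {R : realType} {n} (U : set 'rV[R]_n) (f : 'rV[R]_n -> R) :=
  forall k, Ck k U f.

Section SmoothFunctions.
Context {R : realType} {n : nat} (U : set 'rV[R]_n).
Hypothesis openU : open U.
Implicit Types (f g : 'rV[R]_n -> R) (x : 'rV[R]_n).

Lemma near_eq_on f g x : (forall y, U y -> f y = g y) -> U x ->
  \near x, f x = g x.
Proof.
move=> fg Ux; have : nbhs x U by exact: open_nbhs_nbhs.
by apply: filterS => y; exact: fg.
Qed.

(** The first-order expansion of f at x is also one of g, with the same linear part, because only
    values near x matter. *)
Lemma eq_on_differentiable f g x : (forall y, U y -> f y = g y) -> U x ->
  differentiable f x -> differentiable g x.
Proof.
move=> fg Ux df.
have fgx : f x = g x by exact: fg.
have [dc dE] := (diff_locallyP x f).1 df.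
have gE : g \o shift x = cst (g x) + 'd f x +o_ (0 : 'rV[R]_n) id.
  apply/eqaddoP => e e0; have /eqaddoP/(_ e e0) := dE.
  have := near_eq_on fg Ux; rewrite (near_shift 0) subr0.
  apply: filterS2 => h /= fgh.
  by rewrite -[in X in X -> _]fctE /= -fgx; rewrite !fctE /= fgh.
apply/diff_locallyP; rewrite (diff_unique dc gE).
by split.
Qed.

Lemma eq_on_pderiv f g i x : (forall y, U y -> f y = g y) -> U x ->
  pderiv i f x = pderiv i g x.
Proof. by move=> fg Ux; apply: near_eq_derive; apply: near_eq_on. Qed.

Lemma pderivD f g i x : differentiable f x -> differentiable g x ->
  pderiv i (fun y => f y + g y) x = pderiv i f x + pderiv i g x.
Proof. by move=> df dg; apply: deriveD; exact: diff_derivable. Qed.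

Lemma pderivN f i x : differentiable f x ->
  pderiv i (fun y => - f y) x = - pderiv i f x.
Proof. by move=> df; apply: deriveN; exact: diff_derivable. Qed.

Lemma pderivB f g i x : differentiable f x -> differentiable g x ->
  pderiv i (fun y => f y - g y) x = pderiv i f x - pderiv i g x.
Proof. by move=> df dg; apply: deriveB; exact: diff_derivable. Qed.

Lemma pderivM f g i x : differentiable f x -> differentiable g x ->
  pderiv i (fun y => f y * g y) x = pderiv i f x * g x + f x * pderiv i g x.
Proof.
move=> df dg; rewrite addrC [_ * g x]mulrC.
by apply: deriveM; exact: diff_derivable.
Qed.

Lemma pderiv_cst (c : R) i x : pderiv i (fun=> c) x = 0.
Proof. exact: derive_cst. Qed.

Lemma pderivV f i x : differentiable f x -> f x != 0 ->
  pderiv i (fun y => (f y)^-1) x = - ((f x)^-1 * (f x)^-1 * pderiv i f x).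
Proof.
move=> df f0; rewrite /pderiv deriveV//; last exact: diff_derivable.
by rewrite scaleNr -exprVn expr2.
Qed.

Lemma pderiv_sqrt f i x : differentiable f x -> 0 < f x ->
  pderiv i (fun y => Num.sqrt (f y)) x = 2^-1 * (Num.sqrt (f x))^-1 * pderiv i f x.
Proof.
move=> df f0; have ds : is_derive (f x) 1 Num.sqrt (2 * Num.sqrt (f x))^-1.
  exact: is_derive1_sqrt.
have dfs : differentiable Num.sqrt (f x) by apply/derivable1_diffP.
rewrite /pderiv deriveE; last exact: differentiable_comp.
rewrite (@diff_comp _ _ _ _ f Num.sqrt)//=.
rewrite (deriv1E (@ex_derive _ _ _ _ _ _ _ ds)) /=.
rewrite derive1E derive_val -deriveE// invfM.
by rewrite /GRing.scale /= mulrC.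
Qed.

Lemma differentiable_sqrt f x : differentiable f x -> 0 < f x ->
  differentiable (fun y => Num.sqrt (f y)) x.
Proof.
move=> df f0; have ds : is_derive (f x) 1 Num.sqrt (2 * Num.sqrt (f x))^-1.
  exact: is_derive1_sqrt.
by apply: (@differentiable_comp _ _ _ _ f Num.sqrt) => //; apply/derivable1_diffP.
Qed.

End SmoothFunctions.

Section SmoothAlgebra.
Context {R : realType} {n : nat} (U : set 'rV[R]_n).
Hypothesis openU : open U.
Implicit Types (f g : 'rV[R]_n -> R) (x : 'rV[R]_n) (k : nat).

(** [Ck] speaks of the global functions [pderiv i f], whereas the differentiation rules identify
    them only at points of U. This lemma bridges the gap in every induction on k below. *)
Lemma eq_on_Ck k f g : (forall y, U y -> f y = g y) -> Ck k U f -> Ck k U g.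
Proof.
elim: k f g => [|k IH] f g fg /=.
  move=> cf x Ux; have := cf x Ux.
  rewrite /prop_for /continuous_at (fg x Ux) => cfx.
  have fgx : {near x, f =1 g} by exact: (near_eq_on openU fg Ux).
  exact: cvg_trans (near_eq_cvg fgx) cfx.
move=> [df cf]; split.
  by move=> x Ux; apply: (eq_on_differentiable openU fg Ux); exact: df.
move=> i; apply: IH (cf i) => y Uy; exact: (eq_on_pderiv openU i fg Uy).
Qed.

Lemma CkS k f : Ck k.+1 U f -> Ck k U f.
Proof.
elim: k f => [|k IH] f [df cf]; last by split=> // i; apply: IH; exact: cf.
by move=> x Ux; exact: differentiable_continuous (df x Ux).
Qed.

Lemma Ck_cst k (c : R) : Ck k U (fun=> c).
Proof.
elim: k c => [|k IH] c /=; first by move=> x _; exact: cst_continuous.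
split=> [x _|i]; first exact: differentiable_cst.
by apply: eq_on_Ck (IH 0) => y _; rewrite pderiv_cst.
Qed.

Lemma CkD k f g : Ck k U f -> Ck k U g -> Ck k U (fun x => f x + g x).
Proof.
elim: k f g => [|k IH] f g /=.
  by move=> cf cg x Ux; exact: (cvgD (cf x Ux) (cg x Ux)).
move=> [df cf] [dg cg]; split=> [x Ux|i].
  by apply: differentiableD; [exact: df|exact: dg].
apply: eq_on_Ck (IH _ _ (cf i) (cg i)) => y Uy.
by rewrite pderivD//; [exact: df|exact: dg].
Qed.

Lemma CkM k f g : Ck k U f -> Ck k U g -> Ck k U (fun x => f x * g x).
Proof.
elim: k f g => [|k IH] f g; first move=> /=.
  by move=> cf cg x Ux; exact: (cvgM (cf x Ux) (cg x Ux)).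
move=> Cf Cg; have [df cf] := Cf; have [dg cg] := Cg; split=> [x Ux|i].
  by apply: differentiableM; [exact: df|exact: dg].
apply: eq_on_Ck (CkD (IH _ _ (cf i) (CkS Cg)) (IH _ _ (CkS Cf) (cg i))) => y Uy.
by rewrite pderivM//; [exact: df|exact: dg].
Qed.

Lemma CkN k f : Ck k U f -> Ck k U (fun x => - f x).
Proof.
move=> Cf; apply: eq_on_Ck (CkM (Ck_cst k (-1)) Cf) => y _.
by rewrite mulN1r.
Qed.

(** Bootstrapping with f fixed: the derivative of 1/f is a product of copies of 1/f and of a
    derivative of f, so class k for 1/f gives class k+1. The same scheme proves [Ck_sqrt]. *)
Lemma CkV k f : (forall x, U x -> f x != 0) -> Ck k U f ->
  Ck k U (fun x => (f x)^-1).
Proof.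
move=> f0; elim: k => [/= cf x Ux|k IH Cf].
  exact: (cvgV (f0 x Ux) (cf x Ux)).
have [df cf] := Cf; split=> [x Ux|i].
  exact: (differentiableV (df x Ux) (f0 x Ux)).
have CV := IH (CkS Cf).
apply: eq_on_Ck (CkN (CkM (CkM CV CV) (cf i))) => y Uy.
by rewrite pderivV//; [exact: df|exact: f0].
Qed.

Lemma Ck_sqrt k f : (forall x, U x -> 0 < f x) -> Ck k U f ->
  Ck k U (fun x => Num.sqrt (f x)).
Proof.
move=> f0; elim: k => [/= cf x Ux|k IH Cf].
  apply: (@continuous_comp _ _ _ f Num.sqrt); first exact: cf.
  exact: sqrt_continuous.
have [df cf] := Cf; split=> [x Ux|i].
  by apply: differentiable_sqrt; [exact: df|exact: f0].
have s0 x : U x -> Num.sqrt (f x) != 0.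
  by move=> Ux; rewrite gt_eqF// sqrtr_gt0 f0.
apply: eq_on_Ck (CkM (CkM (Ck_cst k 2^-1) (CkV s0 (IH (CkS Cf)))) (cf i)) => y Uy.
by rewrite pderiv_sqrt//; [exact: df|exact: f0].
Qed.

Lemma smooth_differentiable f x : smooth U f -> U x -> differentiable f x.
Proof. by move=> sf; have [df _] := sf 1%N; exact: df. Qed.

Lemma smooth_continuous f x : smooth U f -> U x -> {for x, continuous f}.
Proof. by move=> sf; exact: sf 0%N x. Qed.

Lemma smooth_pderiv i f : smooth U f -> smooth U (pderiv i f).
Proof. by move=> sf k; case: (sf k.+1) => _; apply. Qed.

Lemma eq_on_smooth f g : (forall y, U y -> f y = g y) -> smooth U f -> smooth U g.
Proof. by move=> fg sf k; exact: eq_on_Ck fg (sf k). Qed.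

Lemma smooth_cst (c : R) : smooth U (fun=> c).
Proof. by move=> k; exact: Ck_cst. Qed.

Lemma smoothD f g : smooth U f -> smooth U g -> smooth U (fun x => f x + g x).
Proof. by move=> sf sg k; exact: CkD. Qed.

Lemma smoothM f g : smooth U f -> smooth U g -> smooth U (fun x => f x * g x).
Proof. by move=> sf sg k; exact: CkM. Qed.

Lemma smoothN f : smooth U f -> smooth U (fun x => - f x).
Proof. by move=> sf k; exact: CkN. Qed.

Lemma smoothV f : (forall x, U x -> f x != 0) -> smooth U f ->
  smooth U (fun x => (f x)^-1).
Proof. by move=> f0 sf k; exact: CkV. Qed.

Lemma smooth_sqrt f : (forall x, U x -> 0 < f x) -> smooth U f ->
  smooth U (fun x => Num.sqrt (f x)).
Proof. by move=> f0 sf k; exact: Ck_sqrt. Qed.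

Lemma smooth_sum (I : Type) (r : seq I) (F : I -> 'rV[R]_n -> R) :
  (forall i, smooth U (F i)) -> smooth U (fun x => \sum_(i <- r) F i x).
Proof.
move=> sF; elim: r => [|i r IH].
  by apply: eq_on_smooth (smooth_cst 0) => x _; rewrite big_nil.
by apply: eq_on_smooth (smoothD (sF i) IH) => x _; rewrite big_cons.
Qed.

Lemma smooth_prod (I : Type) (r : seq I) (F : I -> 'rV[R]_n -> R) :
  (forall i, smooth U (F i)) -> smooth U (fun x => \prod_(i <- r) F i x).
Proof.
move=> sF; elim: r => [|i r IH].
  by apply: eq_on_smooth (smooth_cst 1) => x _; rewrite big_nil.
by apply: eq_on_smooth (smoothM (sF i) IH) => x _; rewrite big_cons.
Qed.

Lemma pderiv_comm f i j x : smooth U f -> U x ->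
  pderiv i (pderiv j f) x = pderiv j (pderiv i f) x.
Proof.
move=> sf Ux; apply: (@derive_comm R _ U) => // [y Uy|y Uy|y Uy||].
- exact: smooth_differentiable sf Uy.
- exact: smooth_differentiable (smooth_pderiv _ sf) Uy.
- exact: smooth_differentiable (smooth_pderiv _ sf) Uy.
- exact: smooth_continuous (smooth_pderiv i (smooth_pderiv j sf)) Ux.
- exact: smooth_continuous (smooth_pderiv j (smooth_pderiv i sf)) Ux.
Qed.

Lemma sub_Ck (W : set 'rV[R]_n) k f : W `<=` U -> Ck k U f -> Ck k W f.
Proof.
move=> WU; elim: k f => [|k IH] f /=; first by move=> cf x /WU; exact: cf.
by move=> [df cf]; split=> [x /WU|i]; [exact: df|exact: IH].
Qed.

End SmoothAlgebra.

(** * Half-space model of the ambient space *)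

Lemma derive_coord {R : realType} {n} (v x : 'rV[R]_n) (a : 'I_n) :
  'D_v (fun z : 'rV[R]_n => z 0 a) x = v 0 a.
Proof.
have /(congr1 (fun w : 'rV[R]_n => w 0 a)) :=
  derive_mx (@derivable_id R 'rV[R]_n x v).
by rewrite derive_id mxE => ->.
Qed.

Lemma derive_Vcoord {R : realType} {n} (v x : 'rV[R]_n) (a : 'I_n) : x 0 a != 0 ->
  'D_v (fun z : 'rV[R]_n => (z 0 a)^-1) x = - ((x 0 a)^-1 * (x 0 a)^-1 * v 0 a).
Proof.
move=> x0; have dx := @differentiable_coord R _ _ x ord0 a.
rewrite deriveV//; last exact: diff_derivable.
by rewrite derive_coord scaleNr -exprVn expr2.
Qed.

Section AmbientGeometry.
Context {R : realType}.
Implicit Types (x v w z : 'rV[R]_5) (a b c : 'I_5) (y : R).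
Local Notation g := (@metric_E11xH4 R).
Local Notation Y := (@ord_max 4).

Definition hdot v w : R := \sum_(a < 4) v 0 (lift ord0 a) * w 0 (lift ord0 a).

Definition hpart v : 'rV[R]_5 := v - v 0 ord0 *: basis_vec ord0.

(* The Christoffel form of the half-space metric at height y is
   y^-1 * Gam v w. *)
Definition Gam v w : 'rV[R]_5 :=
  hdot v w *: basis_vec Y - w 0 Y *: hpart v - v 0 Y *: hpart w.

(** The metric depends on the point only through its height, so the height replaces the point as
    parameter. *)
Definition ip y v w : R := - (v 0 ord0 * w 0 ord0) + y ^- 2 * hdot v w.

Lemma basis_vecE n (a b : 'I_n) : basis_vec a 0 b = (b == a)%:R :> R.
Proof. by rewrite mxE eqxx. Qed.

Lemma hpartE v a : hpart v 0 a = (a != ord0)%:R * v 0 a.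
Proof.
rewrite !mxE eqxx /=; case: eqVneq => [->|_] /=; first by rewrite mulr1 subrr mul0r.
by rewrite mulr0 subr0 mul1r.
Qed.

Lemma GamE v w a : Gam v w 0 a =
  (a == Y)%:R * hdot v w - (a != ord0)%:R * (w 0 Y * v 0 a + v 0 Y * w 0 a).
Proof.
have comb (k1 k2 k3 : R) (p q r : 'rV[R]_5) :
    (k1 *: p - k2 *: q - k3 *: r) 0 a = k1 * p 0 a - k2 * q 0 a - k3 * r 0 a.
  by rewrite !mxE.
by rewrite comb !hpartE basis_vecE; ring.
Qed.

Lemma hdotC v w : hdot v w = hdot w v.
Proof. by apply: eq_bigr => a _; rewrite mulrC. Qed.

Lemma hdotDl u v w : hdot (u + v) w = hdot u w + hdot v w.
Proof. by rewrite -big_split; apply: eq_bigr => a _; rewrite mxE mulrDl. Qed.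

Lemma hdotZl (k : R) v w : hdot (k *: v) w = k * hdot v w.
Proof. by rewrite mulr_sumr; apply: eq_bigr => a _; rewrite mxE mulrA. Qed.

Lemma hdotNl v w : hdot (- v) w = - hdot v w.
Proof. by rewrite -scaleN1r hdotZl mulN1r. Qed.

Lemma hdot_e0l w : hdot (basis_vec ord0) w = 0.
Proof. by rewrite /hdot big1// => a _; rewrite basis_vecE mul0r. Qed.

Lemma hdot_eYl w : hdot (basis_vec Y) w = w 0 Y.
Proof.
rewrite /hdot (bigD1 ord_max)//= big1 ?addr0; last first.
  move=> a aY; rewrite basis_vecE (_ : (_ == _) = false) ?mul0r//.
  by apply: contraNF aY => /eqP/(congr1 val)/= [] aE; apply/eqP/val_inj.
by rewrite basis_vecE (_ : lift ord0 _ = Y) ?eqxx ?mul1r//; apply/val_inj.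
Qed.

Lemma hdot_hpartl v w : hdot (hpart v) w = hdot v w.
Proof. by rewrite hdotDl hdotNl hdotZl hdot_e0l mulr0 subr0. Qed.

Lemma hdot_Gaml u v w : hdot (Gam u v) w =
  hdot u v * w 0 Y - v 0 Y * hdot u w - u 0 Y * hdot v w.
Proof.
by rewrite /Gam !hdotDl !hdotNl !hdotZl hdot_eYl !hdot_hpartl.
Qed.

Lemma hdot_ge0 v : 0 <= hdot v v.
Proof. by apply: sumr_ge0 => a _; rewrite -expr2 sqr_ge0. Qed.

Lemma inner_metricE x v w : inner g x v w = ip (x 0 Y) v w.
Proof.
rewrite /inner /metric_E11xH4 mxE big_ord_recl /ip /hdot mulr_sumr.
congr (_ + _).
  by rewrite mul_mx_diag !mxE eqxx mulrN1 mulNr.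
apply: eq_bigr => a _; rewrite mul_mx_diag !mxE/=.
by rewrite mulrAC mulrC.
Qed.

Lemma pderiv_metric x a b c : x 0 Y != 0 ->
  pderiv b (fun z => g z a c) x =
  ((a == c) && (a != ord0) && (b == Y))%:R * (- 2 * (x 0 Y)^-1 * (x 0 Y) ^- 2).
Proof.
move=> y0; have [<-{c}|ac] /= := eqVneq a c; last first.
  rewrite mul0r (_ : (fun z => _) = (fun=> 0)) ?pderiv_cst//.
  by apply: funext => z; rewrite !mxE (negbTE ac) mulr0n.
have [->|a0] /= := eqVneq a ord0.
  rewrite mul0r (_ : (fun z => _) = (fun=> -1)) ?pderiv_cst//.
  by apply: funext => z; rewrite !mxE eqxx mulr1n.
rewrite (_ : (fun z => _) = (fun z => (z 0 Y)^-1 * (z 0 Y)^-1)); last first.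
  by apply: funext => z; rewrite !mxE eqxx mulr1n (negbTE a0) -exprVn expr2.
have dV : differentiable (fun z : 'rV[R]_5 => (z 0 Y)^-1) x.
  exact: (differentiableV (@differentiable_coord R _ _ x ord0 Y) y0).
rewrite pderivM// /pderiv derive_Vcoord// basis_vecE eq_sym -exprVn.
by ring.
Qed.

Lemma invmx_metric x : x 0 Y != 0 ->
  invmx (g x) = diag_mx (\row_a if a == ord0 then -1 else (x 0 Y) ^+ 2).
Proof.
move=> y0.
have gV : g x *m diag_mx (\row_a if a == ord0 then -1 else (x 0 Y) ^+ 2) = 1%:M.
  rewrite /metric_E11xH4; apply/matrixP => a b; rewrite mul_diag_mx !mxE.
  case: (a =P b) => [_|_]; last by rewrite mulr0n mulr0.
  rewrite !mulr1n; case: eqP => _; first by rewrite mulrNN mulr1.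
  by rewrite mulVf// expf_neq0.
have [gu _] := mulmx1_unit gV.
by rewrite -[LHS]mulmx1 -gV mulKmx.
Qed.

(** The half-space factor is conformally flat with factor y^-2, and this is the conformal formula
    for its symbols; the tests against [ord0] discard the flat time direction. *)
Lemma christoffel_metric x a b c : x 0 Y != 0 ->
  christoffel g x a b c =
  (x 0 Y)^-1 * ((a == Y)%:R * ((b == c) && (b != ord0))%:R
    - (a != ord0)%:R * ((a == b)%:R * (c == Y)%:R + (a == c)%:R * (b == Y)%:R)).
Proof.
move=> y0; rewrite /christoffel invmx_metric// (bigD1 a)//= big1 ?addr0; last first.
  by move=> d da; rewrite !mxE [a == d]eq_sym (negbTE da) mulr0n mul0r.
rewrite !mxE eqxx mulr1n !pderiv_metric//.
have [->|a0] /= := eqVneq a ord0.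
  rewrite (_ : (ord0 == Y) = false)// !andbF.
  by have [->|b0] := eqVneq b ord0; rewrite ?eqxx/= ?(negbTE b0) ?andbF /=; ring.
have -> : (b == a) && (b != ord0) = (a == b).
  by rewrite eq_sym; case: eqVneq => // <-.
rewrite !andbT; do 2![case: (a == _)].
all: case: (b == c); case: (b == _); case: (c == _); case: (b == _) => /=; move: y0.
all: move=> y0; by field.
Qed.

Lemma sum_delta n (F : 'I_n -> R) (a : 'I_n) : \sum_b (a == b)%:R * F b = F a.
Proof.
rewrite (bigD1 a)//= eqxx mul1r big1 ?addr0// => b ba.
by rewrite eq_sym (negbTE ba) mul0r.
Qed.

Lemma christoffel_vec_metric x v w : x 0 Y != 0 ->
  christoffel_vec g x v w = (x 0 Y)^-1 *: Gam v w.
Proof.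
move=> y0; rewrite /christoffel_vec; apply/rowP => a; rewrite [LHS]mxE [RHS]mxE GamE.
rewrite [LHS](_ : _ = (x 0 Y)^-1 *
  \sum_b \sum_c ((a == Y)%:R * ((b == c) && (b != ord0))%:R
    - (a != ord0)%:R * ((a == b)%:R * (c == Y)%:R + (a == c)%:R * (b == Y)%:R))
    * v 0 b * w 0 c); last first.
  rewrite mulr_sumr; apply: eq_bigr => b _; rewrite mulr_sumr.
  by apply: eq_bigr => c _; rewrite christoffel_metric// !mulrA.
congr (_ * _); transitivity (\sum_b ((a == Y)%:R * ((b != ord0)%:R * (v 0 b * w 0 b))
   - (a != ord0)%:R * ((a == b)%:R * (v 0 b * w 0 Y)
                       + (Y == b)%:R * (v 0 b * w 0 a)))).
  apply: eq_bigr => b _.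
  rewrite -[w 0 b](sum_delta (w 0)) -[w 0 Y](sum_delta (w 0)).
  rewrite -[w 0 a](sum_delta (w 0)) !mulr_sumr -big_split /=.
  rewrite !mulr_sumr -sumrN -big_split /=; apply: eq_bigr => c _.
  rewrite [c == Y]eq_sym [b == Y]eq_sym -mulnb natrM; ring.
rewrite big_split /= sumrN -!mulr_sumr big_split /= !sum_delta.
rewrite big_ord_recl eqxx mul0r add0r; congr (_ * _ - _ * _); last by ring.
by apply: eq_bigr => b _; rewrite mul1r.
Qed.

(** Up to the factor y^-2, the curvature tensor h(v,z) w - h(w,z) v of constant curvature -1,
    applied to horizontal parts. *)
Definition Rm v w z : 'rV[R]_5 := hdot v z *: hpart w - hdot w z *: hpart v.

(** The algebraic half of the curvature computation: the nested terms are the quadratic Christoffel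
    terms, and the terms in [v 0 Y] and [w 0 Y] come from differentiating the factor y^-1. *)
Lemma Gam_curvature v w z :
  Gam v (Gam w z) - Gam w (Gam v z) - v 0 Y *: Gam w z + w 0 Y *: Gam v z
  = Rm v w z.
Proof.
apply/rowP => a.
have comb (k1 k2 : R) (p q r s : 'rV[R]_5) :
    (p - q - k1 *: r + k2 *: s) 0 a = p 0 a - q 0 a - k1 * r 0 a + k2 * s 0 a.
  by rewrite !mxE.
have comb2 (k1 k2 : R) (p q : 'rV[R]_5) :
    (k1 *: p - k2 *: q) 0 a = k1 * p 0 a - k2 * q 0 a.
  by rewrite !mxE.
rewrite comb /Rm comb2 !hpartE !GamE !(hdotC _ (Gam _ _)) !hdot_Gaml.
rewrite (hdotC z w) (hdotC w v) (hdotC z v).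
case: (eqVneq a Y) => [->|aY] /=; last case: (eqVneq a ord0) => [->|a0] /=; by ring.
Qed.

Lemma GamDr u v w : Gam u (v + w) = Gam u v + Gam u w.
Proof.
apply/rowP => a; rewrite [RHS]mxE !GamE !(hdotC u) hdotDl !mxE; ring.
Qed.

Lemma GamZr (k : R) u v : Gam u (k *: v) = k *: Gam u v.
Proof.
apply/rowP => a; rewrite [RHS]mxE !GamE !(hdotC u) hdotZl !mxE; ring.
Qed.

Lemma GamC u v : Gam u v = Gam v u.
Proof. by apply/rowP => a; rewrite !GamE hdotC; ring. Qed.

Lemma Gam_e0r v : Gam v (basis_vec ord0) = 0.
Proof.
apply/rowP => a; rewrite GamE hdotC hdot_e0l !basis_vecE [RHS]mxE.
by case: (eqVneq a ord0) => [->|a0] /=; ring.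
Qed.

Lemma curvature_metric x v w z : 0 < x 0 Y ->
  curvature g x v w z = (x 0 Y) ^- 2 *: Rm v w z.
Proof.
move=> y0.
have oU : open (@E11xH4 R).
  rewrite -[E11xH4]/((fun z : 'rV[R]_5 => z 0 Y) @^-1` [set t | 0 < t]).
  by apply: open_comp => [z' _|]; [exact: coord_continuous|exact: open_gt].
have N1 (v' w' p : 'rV[R]_5) : E11xH4 p ->
    nabla g (cst v') (cst w') p = (p 0 Y)^-1 *: Gam v' w'.
  move=> p0; rewrite /nabla christoffel_vec_metric ?gt_eqF//.
  rewrite (_ : \row_a _ = 0) ?add0r//; apply/rowP => a.
  by rewrite !mxE derive_cst.
have N2 (v' w' z' : 'rV[R]_5) : nabla g (cst v') (nabla g (cst w') (cst z')) x =
    (x 0 Y) ^- 2 *: (Gam v' (Gam w' z') - v' 0 Y *: Gam w' z').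
  rewrite -[LHS]/((\row_a 'D_v' (fun p => nabla g (cst w') (cst z') p 0 a) x)
    + christoffel_vec g x v' (nabla g (cst w') (cst z') x)) N1//.
  rewrite christoffel_vec_metric ?gt_eqF// GamZr scalerA -expr2 exprVn.
  rewrite [LHS]addrC [RHS]scalerBr; congr (_ + _); apply/rowP => a.
  have -> : forall (k l : R) (p : 'rV[R]_5), (- (k *: (l *: p))) 0 a = - (k * (l * p 0 a)).
    by move=> k l p; rewrite !mxE.
  (* [N1] holds only at positive height, so the inner derivative is replaced on a neighbourhood of x
     before the outer differentiation. *)
  rewrite mxE (@near_eq_derive _ _ _ _
    (fun p : 'rV[R]_5 => (p 0 Y)^-1 * Gam w' z' 0 a)); last first.
    have : nbhs x (@E11xH4 R) by exact: open_nbhs_nbhs.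
    by apply: filterS => p p0; rewrite N1// mxE.
  have dV : derivable (fun z : 'rV[R]_5 => (z 0 Y)^-1) x v'.
    apply: diff_derivable.
    by apply: (differentiableV (@differentiable_coord R _ _ x ord0 Y)); rewrite gt_eqF.
  rewrite deriveM//.
  rewrite derive_cst scaler0 add0r derive_Vcoord ?gt_eqF//.
  by rewrite -[LHS]/(_ * _) -exprVn; ring.
rewrite /curvature !N2 -scalerBr -Gam_curvature; congr (_ *: _).
by rewrite opprB [w 0 Y *: _ - _]addrC addrACA -[RHS]addrA.
Qed.

End AmbientGeometry.

(** * The Lorentzian form at a fixed height *)

Section InnerProduct.
Context {R : realType} (y : R).
Implicit Types (v w z : 'rV[R]_5).

Lemma ipC v w : ip y v w = ip y w v.
Proof. by rewrite /ip hdotC mulrC. Qed.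

Lemma ipDl u v w : ip y (u + v) w = ip y u w + ip y v w.
Proof. by rewrite /ip hdotDl mxE; ring. Qed.

Lemma ipZl (k : R) v w : ip y (k *: v) w = k * ip y v w.
Proof. by rewrite /ip hdotZl mxE; ring. Qed.

Lemma ipBl u v w : ip y (u - v) w = ip y u w - ip y v w.
Proof. by rewrite ipDl -scaleN1r ipZl mulN1r. Qed.

Lemma ip_d_dt v : ip y v d_dt = - v 0 ord0.
Proof.
by rewrite /ip hdotC hdot_e0l mulr0 addr0 basis_vecE eqxx mulr1.
Qed.

(** On horizontal vectors the negative term vanishes and a positive multiple of a Euclidean square
    remains. *)
Lemma ip_gt0 v : y != 0 -> v 0 ord0 = 0 -> v != 0 -> 0 < ip y v v.
Proof.
move=> y0 v0 vn0; rewrite /ip v0 mul0r oppr0 add0r.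
rewrite mulr_gt0// ?invr_gt0 ?exprn_even_gt0// lt_def hdot_ge0 andbT.
apply: contra vn0; rewrite psumr_eq0; last by move=> a _; rewrite -expr2 sqr_ge0.
move=> /allP vE; apply/eqP/rowP => a; rewrite [RHS]mxE.
case: (unliftP ord0 a) => [b ->|->//].
by have := vE b (mem_index_enum _); rewrite mulf_eq0 orbb => /eqP.
Qed.

(** Pairing with [d_dt] gives minus the time coordinate, so each parenthesis cancels the Lorentzian
    term and equals the H^4 product of horizontal parts. This removes coordinates from the
    curvature. *)
Lemma ip_Rm v w z x : y ^- 2 * ip y (Rm v w z) x =
  (ip y v z + ip y v d_dt * ip y z d_dt) * (ip y w x + ip y w d_dt * ip y x d_dt)
  - (ip y w z + ip y w d_dt * ip y z d_dt) * (ip y v x + ip y v d_dt * ip y x d_dt).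
Proof.
rewrite /Rm ipBl !ipZl !ip_d_dt /ip !hdot_hpartl !hpartE eqxx /=; ring.
Qed.

End InnerProduct.

(* Otherwise unification expands failing matches down to coordinates. *)
Opaque hpart Gam Rm.

(** * Covariant derivatives along a map *)

Section FieldsAlongMap.
Context {R : realType} (U : set 'rV[R]_2) (f : 'rV[R]_2 -> 'rV[R]_5).
Hypotheses (openU : open U) (smooth_f : smooth_on U f).
Hypothesis f_pos : forall u, U u -> 0 < f u 0 ord_max.
Implicit Types (u : 'rV[R]_2) (V W : 'rV[R]_2 -> 'rV[R]_5) (i j : 'I_2).
Implicit Types (c : 'rV[R]_2 -> R).
Local Notation g := (@metric_E11xH4 R).
Local Notation Y := (@ord_max 4).
Local Notation D := (covd g f).
Local Notation F := (frame f).
Local Notation "<[ V , W ]>" := (fun u => ip (f u 0 Y) (V u) (W u)).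

Lemma smooth_cst_field (v : 'rV[R]_5) : smooth_on U (fun=> v).
Proof. by move=> a; exact: smooth_cst. Qed.

Lemma smooth_fieldD V W : smooth_on U V -> smooth_on U W ->
  smooth_on U (fun u => V u + W u).
Proof.
move=> sV sW a; apply: (eq_on_smooth openU _ (smoothD openU (sV a) (sW a))).
by move=> u _; rewrite mxE.
Qed.

Lemma smooth_fieldZ c V : smooth U c -> smooth_on U V ->
  smooth_on U (fun u => c u *: V u).
Proof.
move=> sc sV a; apply: (eq_on_smooth openU _ (smoothM openU sc (sV a))).
by move=> u _; rewrite mxE.
Qed.

Lemma frameE i u a : F i u 0 a = pderiv i (fun z => f z 0 a) u.
Proof. by rewrite mxE. Qed.

Opaque frame.

Lemma smooth_frame i : smooth_on U (F i).
Proof.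
move=> a; apply: (eq_on_smooth openU _ (smooth_pderiv i (smooth_f a))).
by move=> u _; rewrite frameE.
Qed.

Lemma smooth_hdot V W : smooth_on U V -> smooth_on U W ->
  smooth U (fun u => hdot (V u) (W u)).
Proof. by move=> sV sW; apply: smooth_sum => // a; apply: smoothM. Qed.

Lemma height_neq0 u : U u -> f u 0 Y != 0.
Proof. by move=> Uu; rewrite gt_eqF// f_pos. Qed.

Lemma smooth_invheight : smooth U (fun u => (f u 0 Y)^-1).
Proof. exact: (smoothV openU height_neq0 (smooth_f Y)). Qed.

Lemma smooth_ip V W : smooth_on U V -> smooth_on U W -> smooth U <[V, W]>.
Proof.
move=> sV sW.
have s2 := smoothM openU smooth_invheight smooth_invheight.
have s0 := smoothN openU (smoothM openU (sV ord0) (sW ord0)).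
apply: (eq_on_smooth openU _ (smoothD openU s0 (smoothM openU s2 (smooth_hdot sV sW)))).
by move=> u _; rewrite /ip -exprVn expr2.
Qed.

Lemma covdE i V u a : U u ->
  D i V u 0 a = pderiv i (fun z => V z 0 a) u
                + (f u 0 Y)^-1 * Gam (F i u) (V u) 0 a.
Proof.
move=> Uu; rewrite /covd christoffel_vec_metric ?height_neq0//.
by rewrite mxE [X in X + _]mxE [X in _ + X]mxE.
Qed.

Opaque covd.

Lemma smooth_covd i V : smooth_on U V -> smooth_on U (D i V).
Proof.
move=> sV a.
have sF := smooth_frame i.
have sh := smooth_hdot sF sV.
pose G u := (a == Y)%:R * hdot (F i u) (V u)
  + - ((a != ord0)%:R * (V u 0 Y * F i u 0 a + F i u 0 Y * V u 0 a)).
have sG : smooth U G.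
  apply: smoothD => //; first by apply: smoothM => //; exact: smooth_cst.
  apply: smoothN => //; apply: smoothM => //; first exact: smooth_cst.
  by apply: smoothD => //; apply: smoothM.
have sD := smoothD openU (smooth_pderiv i (sV a)) (smoothM openU smooth_invheight sG).
by apply: (eq_on_smooth openU _ sD) => u Uu; rewrite (covdE _ _ _ Uu) GamE.
Qed.

Lemma eq_on_covd i V W u : (forall z, U z -> V z = W z) -> U u ->
  D i V u = D i W u.
Proof.
move=> VW Uu; apply/rowP => a; rewrite 2!(covdE _ _ _ Uu) (VW u Uu).
apply: congr2; last by [].
by apply: (eq_on_pderiv openU) => // z Uz; rewrite VW.
Qed.

Lemma covdD i V W u : smooth_on U V -> smooth_on U W -> U u ->
  D i (fun z => V z + W z) u = D i V u + D i W u.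
Proof.
move=> sV sW Uu; apply/rowP => a; rewrite [RHS]mxE 3!(covdE _ _ _ Uu) GamDr.
rewrite [X in _ + _ * X]mxE.
rewrite (eq_on_pderiv openU (g := fun z => V z 0 a + W z 0 a) i _ Uu); last first.
  by move=> z _; rewrite mxE.
rewrite pderivD ?mulrDr; first by rewrite addrACA.
  exact: smooth_differentiable (sV a) Uu.
exact: smooth_differentiable (sW a) Uu.
Qed.

Lemma covdZ i c V u : smooth U c -> smooth_on U V -> U u ->
  D i (fun z => c z *: V z) u = pderiv i c u *: V u + c u *: D i V u.
Proof.
move=> sc sV Uu; apply/rowP => a.
rewrite [RHS]mxE [X in _ = X + _]mxE [X in _ = _ + X]mxE 2!(covdE _ _ _ Uu) GamZr.
rewrite [X in _ + _ * X]mxE.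
rewrite (eq_on_pderiv openU (g := fun z => c z * V z 0 a) i _ Uu); last first.
  by move=> z _; rewrite mxE.
rewrite pderivM; first by ring.
  exact: smooth_differentiable sc Uu.
exact: smooth_differentiable (sV a) Uu.
Qed.

Lemma covd_d_dt i u : U u -> D i (fun=> d_dt) u = 0.
Proof.
move=> Uu; apply/rowP => a; rewrite (covdE _ _ _ Uu) pderiv_cst Gam_e0r [RHS]mxE.
by rewrite [X in _ * X]mxE mulr0 addr0.
Qed.

Lemma torsion_free i j u : U u -> D i (F j) u = D j (F i) u.
Proof.
move=> Uu; apply/rowP => a; rewrite [LHS](covdE _ _ _ Uu) [RHS](covdE _ _ _ Uu) (GamC (F j u)).
apply: congr2; last by [].
rewrite (eq_on_pderiv openU (g := pderiv j (fun z => f z 0 a)) i _ Uu); last first.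
  by move=> z _; rewrite frameE.
rewrite (pderiv_comm openU i j (smooth_f a) Uu).
by apply: (eq_on_pderiv openU) => // z _; rewrite frameE.
Qed.

Lemma pderiv_sum m (G : 'I_m -> 'rV[R]_2 -> R) i u : U u ->
  (forall k, smooth U (G k)) ->
  pderiv i (fun z => \sum_k G k z) u = \sum_k pderiv i (G k) u.
Proof.
move=> Uu; elim: m G => [|m IH] G sG.
  rewrite big_ord0 -[RHS](pderiv_cst 0 i u).
  by apply: (eq_on_pderiv openU) => // z _; rewrite big_ord0.
rewrite big_ord_recl -IH => [|k]; last exact: sG.
rewrite -pderivD.
- by apply: (eq_on_pderiv openU) => // z _; rewrite big_ord_recl.
- exact: smooth_differentiable (sG _) Uu.
- apply: (@smooth_differentiable _ _ U) => //.
  by apply: smooth_sum => // k; exact: sG.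
Qed.

Lemma pderiv_hdot i V W u : smooth_on U V -> smooth_on U W -> U u ->
  pderiv i (fun z => hdot (V z) (W z)) u =
  hdot (vpderiv i V u) (W u) + hdot (V u) (vpderiv i W u).
Proof.
move=> sV sW Uu.
rewrite pderiv_sum//; last by move=> k; apply: smoothM.
rewrite -big_split; apply: eq_bigr => k _; rewrite pderivM ?mxE//.
  exact: smooth_differentiable (sV _) Uu.
exact: smooth_differentiable (sW _) Uu.
Qed.

Lemma pderiv_Gam i V W u a : smooth_on U V -> smooth_on U W -> U u ->
  pderiv i (fun z => Gam (V z) (W z) 0 a) u =
  Gam (vpderiv i V u) (W u) 0 a + Gam (V u) (vpderiv i W u) 0 a.
Proof.
move=> sV sW Uu.
have dd c : smooth U c -> differentiable c u.
  by move=> sc; exact: smooth_differentiable sc Uu.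
have dh := dd _ (smooth_hdot sV sW).
have dVY := dd _ (sV Y); have dWY := dd _ (sW Y).
have dVa := dd _ (sV a); have dWa := dd _ (sW a).
rewrite (eq_on_pderiv openU (g := fun z => (a == Y)%:R * hdot (V z) (W z)
  - (a != ord0)%:R * (W z 0 Y * V z 0 a + V z 0 Y * W z 0 a)) i _ Uu); last first.
  by move=> z _; rewrite GamE.
have dc (k : R) : differentiable (fun=> k : R) u by exact: differentiable_cst.
have d1 := differentiableM dWY dVa; have d2 := differentiableM dVY dWa.
have d3 := differentiableD d1 d2.
rewrite (pderivB _ (differentiableM (dc _) dh) (differentiableM (dc _) d3)).
rewrite (pderivM _ (dc _) dh) (pderivM _ (dc _) d3) (pderivD _ d1 d2).
rewrite (pderivM _ dWY dVa) (pderivM _ dVY dWa) !pderiv_cst pderiv_hdot//.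
have vE (X : 'rV[R]_2 -> 'rV[R]_5) b : pderiv i (fun z => X z 0 b) u = vpderiv i X u 0 b by rewrite mxE.
by rewrite !vE !GamE; ring.
Qed.

(** Metric compatibility. By [hdot_Gaml], the Christoffel terms of V and of W cancel except for -2
    times the height component of the frame vector times [hdot], which is what differentiating y^-2
    produces. *)
Lemma pderiv_ip i V W u : smooth_on U V -> smooth_on U W -> U u ->
  pderiv i <[V, W]> u = <[D i V, W]> u + <[V, D i W]> u.
Proof.
move=> sV sW Uu.
have dd c : smooth U c -> differentiable c u.
  by move=> sc; exact: smooth_differentiable sc Uu.
have dy := dd _ smooth_invheight.
have dh := dd _ (smooth_hdot sV sW).
rewrite (eq_on_pderiv openU (g := fun z => - (V z 0 ord0 * W z 0 ord0) +
  (f z 0 Y)^-1 * (f z 0 Y)^-1 * hdot (V z) (W z)) i _ Uu); last first.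
  by move=> z _; rewrite /ip -exprVn expr2.
have dV0 := dd _ (sV ord0); have dW0 := dd _ (sW ord0).
rewrite pderivD; last 2 first.
- exact: differentiableN (differentiableM dV0 dW0).
- exact: differentiableM (differentiableM dy dy) dh.
rewrite pderivN; last exact: differentiableM dV0 dW0.
rewrite (pderivM _ dV0 dW0) (pderivM _ (differentiableM dy dy) dh) (pderivM _ dy dy).
rewrite pderivV ?height_neq0//; last exact: dd (smooth_f Y).
rewrite -(frameE i u Y).
have DE X : D i X u = vpderiv i X u + (f u 0 Y)^-1 *: Gam (F i u) (X u).
  by apply/rowP => a; rewrite (covdE _ _ _ Uu) [RHS]mxE [X in _ = X + _]mxE [X in _ = _ + X]mxE.
rewrite pderiv_hdot// /ip 2!(covdE _ _ _ Uu) !DE (hdotC (V u) (_ + _)) !hdotDl !hdotZl !hdot_Gaml.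
rewrite !GamE (hdotC (W u) (V u)) (hdotC (V u) (vpderiv _ _ _)) -!exprVn mulrfctE /=.
ring.
Qed.

(** In the expansion [DD] the second partials of V and of the map are symmetric in the two indices,
    and the first-order terms in V swap roles. Only the combination of [Gam_curvature] survives the
    antisymmetrisation. *)
Lemma covd_commutator i j V u : smooth_on U V -> U u ->
  D i (D j V) u - D j (D i V) u
  = (f u 0 Y) ^- 2 *: Rm (F i u) (F j u) (V u).
Proof.
move=> sV Uu; rewrite -Gam_curvature.
have dd c : smooth U c -> differentiable c u.
  by move=> sc; exact: smooth_differentiable sc Uu.
have dy := dd _ smooth_invheight.
have sG k a : smooth U (fun z => Gam (F k z) (V z) 0 a).
  have sF := smooth_frame k; have sh := smooth_hdot sF sV.
  apply: (eq_on_smooth openU (f := fun z => (a == Y)%:R * hdot (F k z) (V z)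
    + - ((a != ord0)%:R * (V z 0 Y * F k z 0 a + F k z 0 Y * V z 0 a)))).
    by move=> z _; rewrite GamE.
  apply: smoothD => //; first by apply: smoothM => //; exact: smooth_cst.
  apply: smoothN => //; apply: smoothM => //; first exact: smooth_cst.
  by apply: smoothD => //; apply: smoothM.
have DE k : D k V u = vpderiv k V u + (f u 0 Y)^-1 *: Gam (F k u) (V u).
  apply/rowP => b.
  by rewrite (covdE _ _ _ Uu) [RHS]mxE [X in _ = X + _]mxE [X in _ = _ + X]mxE.
have DD k l a : D k (D l V) u 0 a = pderiv k (pderiv l (fun z => V z 0 a)) u
   + (f u 0 Y)^-1 * (Gam (vpderiv k (F l) u) (V u) 0 a + Gam (F l u) (vpderiv k V u) 0 a
                     + Gam (F k u) (vpderiv l V u) 0 a)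
   + (f u 0 Y) ^- 2 * (Gam (F k u) (Gam (F l u) (V u)) 0 a
                        - F k u 0 Y * Gam (F l u) (V u) 0 a).
  rewrite (covdE _ _ _ Uu) (eq_on_pderiv openU (g := fun z => pderiv l (fun z => V z 0 a) z
    + (f z 0 Y)^-1 * Gam (F l z) (V z) 0 a) k _ Uu); last first.
    by move=> z Uz; rewrite covdE.
  have dG := dd _ (sG l a).
  rewrite (pderivD _ (dd _ (smooth_pderiv l (sV a))) (differentiableM dy dG)).
  rewrite (pderivM _ dy dG) pderiv_Gam//; last exact: smooth_frame.
  rewrite pderivV ?height_neq0//; last exact: dd (smooth_f Y).
  rewrite -(frameE k u Y).
  have GD : Gam (F k u) (D l V u) 0 a = Gam (F k u) (vpderiv l V u) 0 a
      + (f u 0 Y)^-1 * Gam (F k u) (Gam (F l u) (V u)) 0 a.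
    rewrite (DE l); move: (vpderiv l V u) (F k u) (Gam (F l u) (V u)) => p q r.
    by rewrite GamDr GamZr [LHS]mxE [X in _ + X]mxE.
  have alg (P y' q G1 A1 A2 A3 B Z : R) : Z = A3 + y' * B ->
      P + (- (y' * y' * q) * G1 + y' * (A1 + A2)) + y' * Z =
      P + y' * (A1 + A2 + A3) + y' ^+ 2 * (B - q * G1) by move=> ->; ring.
  by rewrite -exprVn; exact: alg GD.
have vF : vpderiv i (F j) u = vpderiv j (F i) u.
  apply/rowP => a; rewrite [LHS]mxE [RHS]mxE.
  rewrite (eq_on_pderiv openU (g := pderiv j (fun z => f z 0 a)) i _ Uu); last first.
    by move=> z _; rewrite frameE.
  rewrite (pderiv_comm openU i j (smooth_f a) Uu).
  by apply: (eq_on_pderiv openU) => // z _; rewrite frameE.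
apply/rowP => a.
have combL (p q : 'rV[R]_5) : (p - q) 0 a = p 0 a - q 0 a by rewrite !mxE.
have combR (c k l : R) (p q r s : 'rV[R]_5) :
    (c *: (p - q - k *: r + l *: s)) 0 a
    = c * (p 0 a - q 0 a - k * r 0 a + l * s 0 a).
  by rewrite !mxE.
rewrite [LHS]combL [RHS]combR.
have alg (X Z P P' y' A1 A1' A2 A3 B C D' G1 G2 q r : R) :
    X = P + y' * (A1 + A2 + A3) + q * (B - r * G1) ->
    Z = P' + y' * (A1' + A3 + A2) + q * (C - D' * G2) -> P = P' -> A1 = A1' ->
    X - Z = q * (B - C - r * G1 + D' * G2) by move=> -> -> -> ->; ring.
apply: alg (DD i j a) (DD j i a) (pderiv_comm openU i j (sV a) Uu) _.
exact: (congr1 (fun X => Gam X (V u) 0 a) vF).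
Qed.

End FieldsAlongMap.

(** * Surfaces with parallel mean curvature *)

Lemma sum2 (V : nmodType) (F : 'I_2 -> V) : \sum_i F i = F ord0 + F ord_max.
Proof. by rewrite big_ord_recr big_ord1; congr (F _ + _); apply: val_inj. Qed.

Lemma ind2 (P : 'I_2 -> Prop) : P ord0 -> P ord_max -> forall i, P i.
Proof.
move=> P0 P1 [[|[|//]] i2].
  by rewrite (_ : Ordinal i2 = ord0)//; apply: val_inj.
by rewrite (_ : Ordinal i2 = ord_max)//; apply: val_inj.
Qed.

(* The rules obeyed by the calculus of an immersed space-like surface: [sm] and
   [smV] are the smooth functions and the smooth ambient fields along the
   surface, [dd] and [D] their (covariant) coordinate derivatives, [B] the
   ambient metric, [dt] the parallel field d/dt, [Rc] the ambient curvature,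
   [F] the coordinate frame and [G] the inverse of its Gram matrix. Keeping
   them abstract separates the geometric argument from the coordinates. *)
Record surface_calculus {R : realType} {P : Type} {E : lmodType R}
    (U : P -> Prop) (sm : (P -> R) -> Prop) (smV : (P -> E) -> Prop)
    (dd : 'I_2 -> (P -> R) -> P -> R) (D : 'I_2 -> (P -> E) -> P -> E)
    (B : P -> E -> E -> R) (dt : E) (Rc : P -> E -> E -> E -> E)
    (F : 'I_2 -> P -> E) (G : 'I_2 -> 'I_2 -> P -> R) : Prop := {
  sc_smC : forall k : R, sm (fun=> k);
  sc_smD : forall c d, sm c -> sm d -> sm (fun z => c z + d z);
  sc_smM : forall c d, sm c -> sm d -> sm (fun z => c z * d z);
  sc_smN : forall c, sm c -> sm (fun z => - c z);
  sc_smI : forall c, (forall z, U z -> c z != 0) -> sm c -> sm (fun z => (c z)^-1);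
  sc_smQ : forall c, (forall z, U z -> 0 < c z) -> sm c -> sm (fun z => Num.sqrt (c z));
  sc_smB : forall V W, smV V -> smV W -> sm (fun z => B z (V z) (W z));
  sc_smVD : forall V W, smV V -> smV W -> smV (fun z => V z + W z);
  sc_smVZ : forall c V, sm c -> smV V -> smV (fun z => c z *: V z);
  sc_smVc : forall i V, smV V -> smV (D i V);
  sc_smVF : forall i, smV (F i);
  sc_smVdt : smV (fun=> dt);
  sc_smG : forall i j, sm (G i j);
  sc_dd_eq : forall i c d u, (forall z, U z -> c z = d z) -> U u -> dd i c u = dd i d u;
  sc_ddC : forall i (k : R) u, dd i (fun=> k) u = 0;
  sc_ddD : forall i c d u, sm c -> sm d -> U u ->
    dd i (fun z => c z + d z) u = dd i c u + dd i d u;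
  sc_ddN : forall i c u, sm c -> U u -> dd i (fun z => - c z) u = - dd i c u;
  sc_ddM : forall i c d u, sm c -> sm d -> U u ->
    dd i (fun z => c z * d z) u = dd i c u * d u + c u * dd i d u;
  sc_D_eq : forall i V W u, (forall z, U z -> V z = W z) -> U u -> D i V u = D i W u;
  sc_DD : forall i V W u, smV V -> smV W -> U u ->
    D i (fun z => V z + W z) u = D i V u + D i W u;
  sc_DZ : forall i c V u, sm c -> smV V -> U u ->
    D i (fun z => c z *: V z) u = dd i c u *: V u + c u *: D i V u;
  sc_Ddt : forall i u, U u -> D i (fun=> dt) u = 0;
  sc_ddB : forall i V W u, smV V -> smV W -> U u ->
    dd i (fun z => B z (V z) (W z)) u = B u (D i V u) (W u) + B u (V u) (D i W u);
  sc_torsion : forall i j u, U u -> D i (F j) u = D j (F i) u;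
  sc_comm : forall i j V u, smV V -> U u ->
    D i (D j V) u - D j (D i V) u = Rc u (F i u) (F j u) (V u);
  sc_BC : forall u v w, B u v w = B u w v;
  sc_BD : forall u v w x, B u (v + w) x = B u v x + B u w x;
  sc_BZ : forall u k v x, B u (k *: v) x = k * B u v x;
  sc_Bpos : forall u v, U u -> B u v dt = 0 -> v != 0 -> 0 < B u v v;
  (* [B u v w + B u v dt * B u w dt] is the metric of H^4 extended by 0. *)
  sc_BR : forall u v w z x, U u -> B u (Rc u v w z) x =
    (B u v z + B u v dt * B u z dt) * (B u w x + B u w dt * B u x dt)
    - (B u w z + B u w dt * B u z dt) * (B u v x + B u v dt * B u x dt);
  sc_GC : forall i j u, U u -> G i j u = G j i u;
  sc_GK : forall i k u, U u ->
    \sum_j G i j u * B u (F j u) (F k u) = (i == k)%:R;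
  sc_Gpos : forall (w : 'I_2 -> R) u, U u ->
    0 <= \sum_i \sum_j G i j u * (w i * w j);
  sc_gpos : forall (w : 'I_2 -> R) i u, U u -> w i != 0 ->
    0 < \sum_i \sum_j w i * w j * B u (F i u) (F j u)
}.

(** * Gauss formula, mean curvature and tension in the abstract calculus *)

Section SurfaceCalculus.
Context {R : realType} {P : Type} {E : lmodType R}
    (U : P -> Prop) (sm : (P -> R) -> Prop) (smV : (P -> E) -> Prop)
    (dd : 'I_2 -> (P -> R) -> P -> R) (D : 'I_2 -> (P -> E) -> P -> E)
    (B : P -> E -> E -> R) (dt : E) (Rc : P -> E -> E -> E -> E)
    (F : 'I_2 -> P -> E) (G : 'I_2 -> 'I_2 -> P -> R).
Hypothesis S : surface_calculus U sm smV dd D B dt Rc F G.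
Local Notation I0 := (@ord0 1).
Local Notation I1 := (@ord_max 1).
Implicit Types (i j k l m : 'I_2) (u : P) (V W : P -> E).

Let BC := sc_BC S.
Let BD := sc_BD S.
Let BZ := sc_BZ S.

Lemma form_addr u x v w : B u x (v + w) = B u x v + B u x w.
Proof. by rewrite ![B u x _]BC BD. Qed.

Lemma form_scaler u x (k : R) v : B u x (k *: v) = k * B u x v.
Proof. by rewrite ![B u x _]BC BZ. Qed.

Lemma form_0l u x : B u 0 x = 0.
Proof. by rewrite -(scale0r 0) BZ mul0r. Qed.

Lemma form_0r u x : B u x 0 = 0.
Proof. by rewrite BC form_0l. Qed.

Lemma form_oppl u v x : B u (- v) x = - B u v x.
Proof. by rewrite -scaleN1r BZ mulN1r. Qed.

(** A vector orthogonal to everything is orthogonal to [dt], and there the form is positive. This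
    allows vector identities to be proved by pairing with an arbitrary x. *)
Lemma form_nondegenerate u v : U u -> (forall x, B u v x = 0) -> v = 0.
Proof.
move=> Uu v0; apply/eqP; apply: contraT => vn0.
by have := sc_Bpos S Uu (v0 dt) vn0; rewrite v0 ltxx.
Qed.

Lemma form_cst_derivative i V W u (k : R) : smV V -> smV W -> U u ->
  (forall z, U z -> B z (V z) (W z) = k) ->
  B u (D i V u) (W u) = - B u (V u) (D i W u).
Proof.
move=> sV sW Uu VW; apply/eqP; rewrite -addr_eq0 -(sc_ddB S i sV sW Uu).
by rewrite (sc_dd_eq S i VW Uu) (sc_ddC S).
Qed.

(** The inverse Gram relation in scalar form. Later proofs multiply these equations by a suitable
    factor so that the goal becomes linear in monomials, within reach of [lra]. *)
Lemma cogram_gram u : U u ->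
  [/\ G I0 I0 u * B u (F I0 u) (F I0 u) + G I0 I1 u * B u (F I0 u) (F I1 u) = 1,
      G I0 I0 u * B u (F I0 u) (F I1 u) + G I0 I1 u * B u (F I1 u) (F I1 u) = 0,
      G I0 I1 u * B u (F I0 u) (F I0 u) + G I1 I1 u * B u (F I0 u) (F I1 u) = 0 &
      G I0 I1 u * B u (F I0 u) (F I1 u) + G I1 I1 u * B u (F I1 u) (F I1 u) = 1].
Proof.
move=> Uu; have GC := sc_GC S I1 I0 Uu; have K i k := sc_GK S i k Uu.
have := K I0 I0; have := K I0 I1; have := K I1 I0; have := K I1 I1.
by rewrite !sum2 GC [B u (F I1 u) (F I0 u)]BC /= => -> -> -> ->.
Qed.

Definition tangential u v := \sum_i \sum_j G i j u *: (B u v (F i u) *: F j u).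
Definition second_fund u i j := D i (F j) u - tangential u (D i (F j) u).
Definition mean_curv u := 2^-1 *: \sum_i \sum_j G i j u *: second_fund u i j.
(** Christoffel symbols read off from the ambient connection, without derivatives of the metric;
    [koszul] relates them to the usual formula. *)
Definition induced_christoffel k i j u := \sum_d G k d u * B u (D i (F j) u) (F d u).

Lemma form_tangential u v l : U u -> B u (tangential u v) (F l u) = B u v (F l u).
Proof.
move=> Uu; have [K00 K01 K10 K11] := cogram_gram Uu.
rewrite /tangential !sum2 !BD !BZ (sc_GC S I1 I0 Uu).
elim/ind2: l; rewrite ?[B u (F I1 u) (F I0 u)]BC.
  have := congr1 ( *%R (B u v (F I0 u))) K00; have := congr1 ( *%R (B u v (F I1 u))) K10.
  by lra.
have := congr1 ( *%R (B u v (F I0 u))) K01; have := congr1 ( *%R (B u v (F I1 u))) K11.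
by lra.
Qed.

Lemma form_tangential_normal u v w : (forall l, B u w (F l u) = 0) ->
  B u (tangential u v) w = 0.
Proof.
move=> wn; rewrite /tangential !sum2 !BD !BZ ![B u (F _ u) w]BC !wn.
by rewrite !mulr0 !addr0.
Qed.

Lemma tangentialE u v : tangential u v = \sum_k (\sum_m G m k u * B u v (F m u)) *: F k u.
Proof.
rewrite /tangential exchange_big; apply: eq_bigr => k _.
by rewrite scaler_suml; apply: eq_bigr => m _; rewrite scalerA.
Qed.

Lemma tangential_christoffel u i j : U u ->
  \sum_k induced_christoffel k i j u *: F k u = tangential u (D i (F j) u).
Proof.
move=> Uu; rewrite tangentialE; apply: eq_bigr => k _; congr (_ *: _).
by apply: eq_bigr => m _; rewrite (sc_GC S k m Uu).
Qed.

(** Gauss formula: after metric compatibility the three derivatives give six terms, of which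
    torsion-freeness cancels four and doubles the one wanted. *)
Lemma koszul k i j u : U u ->
  2^-1 * \sum_d G k d u * (dd i (fun z => B z (F d z) (F j z)) u
    + dd j (fun z => B z (F i z) (F d z)) u - dd d (fun z => B z (F i z) (F j z)) u)
  = induced_christoffel k i j u.
Proof.
move=> Uu; rewrite mulr_sumr; apply: eq_bigr => d _.
have sF k' := sc_smVF S k'.
rewrite !(sc_ddB S _ (sF _) (sF _) Uu).
rewrite (sc_torsion S j i Uu) (sc_torsion S d i Uu) (sc_torsion S d j Uu).
rewrite (BC _ (F d u)) (BC _ (F i u)).
by field.
Qed.

Lemma mean_curv_normal u l : U u -> B u (mean_curv u) (F l u) = 0.
Proof.
move=> Uu; have n i j : B u (second_fund u i j) (F l u) = 0.
  by rewrite /second_fund BD form_oppl form_tangential// subrr.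
by rewrite /mean_curv !sum2 BZ !BD !BZ !n; ring.
Qed.

Lemma mean_curv_trace u v : U u -> (forall l, B u v (F l u) = 0) ->
  \sum_i \sum_j G i j u * B u (D i (F j) u) v = 2 * B u (mean_curv u) v.
Proof.
move=> Uu vn; have n i j : B u (second_fund u i j) v = B u (D i (F j) u) v.
  by rewrite /second_fund BD form_oppl form_tangential_normal// subr0.
by rewrite /mean_curv !sum2 BZ !BD !BZ !n; field.
Qed.

Lemma smooth_mean_curv : smV mean_curv.
Proof.
have sF i := sc_smVF S i; have sD i j := sc_smVc S i (sF j).
have sG := sc_smG S; have sVD := sc_smVD S; have sVZ := sc_smVZ S.
have sT V : smV V -> smV (fun u => tangential u (V u)).
  move=> sV; have sVij i j := sVZ _ _ (sG i j) (sVZ _ _ (sc_smB S sV (sF i)) (sF j)).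
  apply: (eq_ind _ smV (sVD _ _ (sVD _ _ (sVij I0 I0) (sVij I0 I1))
    (sVD _ _ (sVij I1 I0) (sVij I1 I1)))).
  by apply: funext => z; rewrite /tangential !sum2.
have sS i j := sVZ _ _ (sG i j)
  (sVD _ _ (sD i j) (sVZ _ _ (sc_smC S (-1)) (sT _ (sD i j)))).
apply: (eq_ind _ smV (sVZ _ _ (sc_smC S 2^-1) (sVD _ _ (sVD _ _ (sS I0 I0) (sS I0 I1))
  (sVD _ _ (sS I1 I0) (sS I1 I1))))).
by apply: funext => z; rewrite /mean_curv /second_fund !sum2 !scaleN1r.
Qed.

(** The Christoffel sum is the tangential part of D_i F_j, so the bracket is the second fundamental
    form. *)
Lemma tension_mean_curv u : U u ->
  \sum_i \sum_j G i j u *: (D i (F j) u - \sum_k induced_christoffel k i j u *: F k u)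
  = 2 *: mean_curv u.
Proof.
move=> Uu; rewrite /mean_curv scalerA divff ?pnatr_eq0// scale1r.
by apply: eq_bigr => i _; apply: eq_bigr => j _; rewrite tangential_christoffel.
Qed.

(** * Parallel normal field: symmetry of the shape form and biconservativity *)

Section ParallelNormalField.
Variable H : P -> E.
Hypotheses (sH : smV H) (normalH : forall u l, U u -> B u (H u) (F l u) = 0).
Hypothesis traceH : forall u v, U u -> (forall l, B u v (F l u) = 0) ->
  \sum_i \sum_j G i j u * B u (D i (F j) u) v = 2 * B u (H u) v.
Hypothesis parallelH : forall j u, U u ->
  D j H u = \sum_k (\sum_m G m k u * B u (D j H u) (F m u)) *: F k u.
Hypothesis t_neq0 : forall u, U u -> exists l, B u (F l u) dt != 0.

(** [b] is minus the bilinear form of the shape operator A_H, and [a] is [b] with its second index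
    raised: by [parallelH] its entries are the components of D_i H in the frame. *)
Let b i j u := B u (D i H u) (F j u).
Let C i j l u := B u (D i (F j) u) (F l u).
Let a i k u := \sum_m G m k u * b i m u.

Lemma shapeE i j u : U u -> b i j u = - B u (D i (F j) u) (H u).
Proof.
move=> Uu; rewrite /b (form_cst_derivative i sH (sc_smVF S j) Uu (k := 0)).
  by rewrite BC.
by move=> z Uz; rewrite normalH.
Qed.

Lemma shape_sym i j u : U u -> b i j u = b j i u.
Proof. by move=> Uu; rewrite !shapeE// (sc_torsion S i j Uu). Qed.

Lemma smooth_shape i j : sm (b i j).
Proof. by apply: (sc_smB S); [exact: (sc_smVc S)|exact: (sc_smVF S)]. Qed.

Lemma norm_parallel i u : U u -> B u (D i H u) (H u) = 0.
Proof.
move=> Uu; rewrite parallelH// sum2 BD !BZ ![B u (F _ u) _]BC !normalH//.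
by rewrite !mulr0 addr0.
Qed.

Lemma trace_shape u : U u -> \sum_i \sum_j G i j u * b i j u = - (2 * B u (H u) (H u)).
Proof.
move=> Uu; rewrite -traceH//; last by move=> l; exact: normalH.
rewrite -sumrN; apply: eq_bigr => i _; rewrite -sumrN; apply: eq_bigr => j _.
by rewrite shapeE// mulrN.
Qed.

(** As D_j H is tangent, both sides equal the covariant derivative of [b] in the direction i,
    evaluated on (j,l) and on (l,j), and [b] is symmetric. *)
Lemma second_derivative_sym i j l u : U u ->
  B u (D i (D j H) u) (F l u) - \sum_k induced_christoffel k i j u * b k l u
  = B u (D i (D l H) u) (F j u) - \sum_k induced_christoffel k i l u * b k j u.
Proof.
move=> Uu.
have E1 j' l' : B u (D i (D j' H) u) (F l' u) =
    dd i (b j' l') u - \sum_k a j' k u * C i l' k u.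
  rewrite (sc_ddB S i (sc_smVc S j' sH) (sc_smVF S l') Uu).
  have -> : B u (D j' H u) (D i (F l') u) = \sum_k a j' k u * C i l' k u.
    by rewrite parallelH// !sum2 BD !BZ !(BC _ _ (D i _ u)) /a /b !sum2.
  by rewrite addrK.
rewrite !E1 (sc_dd_eq S i (d := b l j) _ Uu); last by move=> z Uz; exact: shape_sym.
rewrite /a /C /induced_christoffel !sum2 (shape_sym I0 l Uu) (shape_sym I1 l Uu).
rewrite (shape_sym I0 j Uu) (shape_sym I1 j Uu) (sc_GC S I1 I0 Uu).
by ring.
Qed.

(** The sum is the derivative of the trace of [b], that is of -2|H|^2, which is constant because D H
    is tangent and H is normal. *)
Lemma trace_second_derivative l u : U u ->
  \sum_i \sum_j G i j u * (B u (D l (D i H) u) (F j u)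
    - \sum_k induced_christoffel k l i u * b k j u) = 0.
Proof.
move=> Uu.
have sa i k : sm (a i k).
  rewrite (_ : a i k = fun z => G I0 k z * b i I0 z + G I1 k z * b i I1 z).
    by apply: (sc_smD S); apply: (sc_smM S);
      solve [exact: (sc_smG S)|exact: smooth_shape].
  by apply: funext => z; rewrite /a sum2.
have DDH i : D l (D i H) u = dd l (a i I0) u *: F I0 u + a i I0 u *: D l (F I0) u
    + (dd l (a i I1) u *: F I1 u + a i I1 u *: D l (F I1) u).
  rewrite (sc_D_eq S l (W := fun z => a i I0 z *: F I0 z + a i I1 z *: F I1 z) _ Uu).
    have sF k : smV (F k) by exact: (sc_smVF S).
    rewrite (sc_DD S l (sc_smVZ S (sa _ _) (sF _)) (sc_smVZ S (sa _ _) (sF _)) Uu).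
    by rewrite !(sc_DZ S l (sa _ _) (sF _) Uu).
  by move=> z Uz; rewrite parallelH// sum2.
have tr0 : dd l (a I0 I0) u + dd l (a I1 I1) u = 0.
  rewrite -(sc_ddD S l (sa _ _) (sa _ _) Uu).
  have sHH := sc_smB S sH sH.
  rewrite (sc_dd_eq S l (d := fun z => - (B z (H z) (H z) + B z (H z) (H z))) _ Uu).
    rewrite (sc_ddN S l (sc_smD S sHH sHH) Uu) (sc_ddD S l sHH sHH Uu).
    by rewrite (sc_ddB S l sH sH Uu) (BC _ (H u)) norm_parallel// !addr0 oppr0.
  move=> z Uz; have := trace_shape Uz; rewrite /a !sum2 => tr.
  have -> : B z (H z) (H z) + B z (H z) (H z) = 2 * B z (H z) (H z) by ring.
  by rewrite -tr (sc_GC S I1 I0 Uz); ring.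
have [K00 K01 K10 K11] := cogram_gram Uu.
(* The derivatives of [a] occur contracted with the product of [G] and the Gram matrix. The factors
   1 and 0 are placeholders for the entries of that product and are expanded next. *)
transitivity ((dd l (a I0 I0) u) * 1 + (dd l (a I1 I1) u) * 1
  + dd l (a I0 I1) u * 0 + dd l (a I1 I0) u * 0); last first.
  by rewrite !mulr1 !mulr0 !addr0.
rewrite -[in X in X + _ * 1]K00 -[in X in _ + X + _ * 0 + _]K11.
rewrite -[in X in _ + X + _]K01 -[in X in _ + _ + X]K10.
rewrite !sum2 !DDH !BD !BZ /induced_christoffel /a !sum2 (sc_GC S I1 I0 Uu).
rewrite [B u (F I1 u) (F I0 u)]BC (shape_sym I1 I0 Uu).
by ring.
Qed.

(** Swapping indices by [second_derivative_sym] and commuting D_i with D_l turns the left side into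
    a vanishing trace plus a curvature trace. With h = <H,dt> and t_l = <F_l,dt>, that trace is -h
    t_l and the right side is h t_l; hence 2 h t_l = 0, and some t_l is nonzero. *)
Lemma horizontal_of_biconservative :
  (forall l u, U u ->
    \sum_i \sum_j G i j u * (B u (D i (D j H) u) (F l u)
      - \sum_k induced_christoffel k i j u * b k l u)
    = \sum_i \sum_j G i j u * B u (Rc u (F i u) (H u) (F j u)) (F l u)) ->
  forall u, U u -> B u (H u) dt = 0.
Proof.
move=> bic u Uu; have [l tl] := t_neq0 Uu.
have := bic l u Uu.
have E1 i j : B u (D i (D j H) u) (F l u) - \sum_k induced_christoffel k i j u * b k l u
   = B u (D l (D i H) u) (F j u) - \sum_k induced_christoffel k l i u * b k j u
     + B u (Rc u (F i u) (F l u) (H u)) (F j u).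
  rewrite second_derivative_sym//.
  have -> : D i (D l H) u = D l (D i H) u + Rc u (F i u) (F l u) (H u).
    by rewrite -(sc_comm S i l sH Uu) addrC subrK.
  have GE k : induced_christoffel k i l u = induced_christoffel k l i u.
    by apply: eq_bigr => d _; rewrite (sc_torsion S i l Uu).
  by rewrite BD addrAC; congr (_ - _ + _); apply: eq_bigr => k _; rewrite GE.
under eq_bigr do under eq_bigr do rewrite E1 mulrDr.
under eq_bigr do rewrite big_split /=.
rewrite big_split /= trace_second_derivative// add0r => /eqP.
rewrite -subr_eq0 => /eqP eq0.
have [K00 K01 K10 K11] := cogram_gram Uu.
have nH i : B u (F i u) (H u) = 0 by rewrite BC normalH.
suff : B u (H u) dt * B u (F l u) dt * 2 = 0.
  move=> /eqP; rewrite !mulf_eq0 (negbTE tl) pnatr_eq0 !orbF => /eqP//.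
move: eq0; rewrite !sum2 !(sc_BR S) //.
rewrite !nH !normalH// (sc_GC S I1 I0 Uu) [B u (F I1 u) (F I0 u)]BC.
set h := B u (H u) dt; set t0 := B u (F I0 u) dt; set t1 := B u (F I1 u) dt.
move: K00 K01 K10 K11.
move: l {bic E1 tl}; apply: ind2; rewrite -/t0 -/t1 ?[B u (F I1 u) (F I0 u)]BC.
  move=> K00 K01 K10 K11 eq0.
  have := congr1 ( *%R (h * t1)) K10; have := congr1 ( *%R (h * t0)) K11.
  by move: eq0; lra.
move=> K00 K01 K10 K11 eq0.
have := congr1 ( *%R (h * t0)) K01; have := congr1 ( *%R (h * t1)) K00.
by move: eq0; lra.
Qed.

(** * Horizontal H: the unit field [e], its derivative, and the contradiction *)

Hypothesis horizontalH : forall u, U u -> B u (H u) dt = 0.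
Hypothesis H_neq0 : forall u, U u -> H u != 0.

Let t i u := B u (F i u) dt.
(** The squared length of t_1 F_0 - t_0 F_1, a tangent vector orthogonal to [dt]; [e] is its
    normalisation. *)
Let q u := t I1 u ^+ 2 * B u (F I0 u) (F I0 u)
  - 2 * t I0 u * t I1 u * B u (F I0 u) (F I1 u) + t I0 u ^+ 2 * B u (F I1 u) (F I1 u).
Let e0 u := t I1 u * (Num.sqrt (q u))^-1.
Let e1 u := - (t I0 u * (Num.sqrt (q u))^-1).
(* The unit tangent field orthogonal to T. *)
Let e u := e0 u *: F I0 u + e1 u *: F I1 u.
Let th i u := B u (e u) (F i u).
(** 2|H|^2, written as a sum so that the additive rules of the calculus apply directly. *)
Let lam u := B u (H u) (H u) + B u (H u) (H u).

Lemma q_gt0 u : U u -> 0 < q u.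
Proof.
move=> Uu; have [l tl] := t_neq0 Uu.
pose w i := if i == I0 then t I1 u else - t I0 u.
have [i wi] : exists i, w i != 0.
  by elim/ind2: l tl => tl; [exists I1|exists I0]; rewrite /w /= ?oppr_eq0.
have := sc_gpos S Uu wi; rewrite !sum2 /w /= [B u (F I1 u) (F I0 u)]BC.
by congr (_ < _); rewrite /q; ring.
Qed.

Lemma smooth_sqrtq_inv : sm (fun u => (Num.sqrt (q u))^-1).
Proof.
have sF i := sc_smVF S i.
have st i : sm (t i) by exact: (sc_smB S (sF i) (sc_smVdt S)).
have sg i j := sc_smB S (sF i) (sF j).
have sq : sm q.
  have sM := sc_smM S; have sD := sc_smD S; have sN := sc_smN S.
  have h := sD _ _ (sD _ _ (sM _ _ (sM _ _ (st I1) (st I1)) (sg I0 I0))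
    (sN _ (let c := sM _ _ (sM _ _ (st I0) (st I1)) (sg I0 I1) in sD _ _ c c)))
    (sM _ _ (sM _ _ (st I0) (st I0)) (sg I1 I1)).
  by apply: (eq_ind _ sm h); apply: funext => z; rewrite /q /=; ring.
apply: (sc_smI S) => [z Uz|]; first by rewrite gt_eqF// sqrtr_gt0 q_gt0.
by apply: (sc_smQ S) sq; exact: q_gt0.
Qed.

Lemma smooth_e : smV e.
Proof.
have sF i := sc_smVF S i.
have st i : sm (t i) by exact: (sc_smB S (sF i) (sc_smVdt S)).
have sq := smooth_sqrtq_inv.
exact: (sc_smVD S (sc_smVZ S (sc_smM S (st I1) sq) (sF I0))
  (sc_smVZ S (sc_smN S (sc_smM S (st I0) sq)) (sF I1))).
Qed.

Lemma smooth_th i : sm (th i).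
Proof. exact: (sc_smB S smooth_e (sc_smVF S i)). Qed.

Lemma thE u i : th i u = e0 u * B u (F I0 u) (F i u) + e1 u * B u (F I1 u) (F i u).
Proof. by rewrite /th /e BD !BZ. Qed.

Lemma e_unit u : U u -> B u (e u) (e u) = 1.
Proof.
move=> Uu; have q0 := q_gt0 Uu.
have r0 : Num.sqrt (q u) != 0 by rewrite gt_eqF// sqrtr_gt0.
have := sqr_sqrtr (ltW q0); move: r0.
rewrite {1}/e BD !BZ ![B u (F _ u) (e u)]BC -!/(th _ u) !thE /e0 /e1.
rewrite [B u (F I1 u) (F I0 u)]BC.
set r := Num.sqrt (q u) => r0 r2; apply: (mulIf (expf_neq0 2 r0)).
by rewrite mul1r [RHS]r2 /q; field.
Qed.

Lemma e_horizontal u : B u (e u) dt = 0.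
Proof. by rewrite /e BD !BZ -!/(t _ u) /e0 /e1; ring. Qed.

Lemma e_th u : U u -> e0 u * th I0 u + e1 u * th I1 u = 1.
Proof.
move=> Uu; rewrite -(e_unit Uu) [in RHS]/e BD !BZ.
by rewrite ![B u (F _ u) (_ + _)]BC.
Qed.

Lemma normal_e u v : (forall l, B u v (F l u) = 0) -> B u v (e u) = 0.
Proof. by move=> vF; rewrite /e form_addr !form_scaler !vF !mulr0 addr0. Qed.

Lemma form_e u v : B u v (e u) = e0 u * B u v (F I0 u) + e1 u * B u v (F I1 u).
Proof. by rewrite /e form_addr !form_scaler. Qed.

(** Raising the index of the form theta dual to [e] returns the components of [e]. *)
Lemma cogram_th (X : 'I_2 -> R) u : U u ->
  \sum_i \sum_j G i j u * (th i u * X j) = e0 u * X I0 + e1 u * X I1.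
Proof.
move=> Uu; have [K00 K01 K10 K11] := cogram_gram Uu.
rewrite !sum2 !thE (sc_GC S I1 I0 Uu) [B u (F I1 u) (F I0 u)]BC.
have := congr1 ( *%R (e0 u * X I0)) K00; have := congr1 ( *%R (e1 u * X I0)) K01.
have := congr1 ( *%R (e0 u * X I1)) K10; have := congr1 ( *%R (e1 u * X I1)) K11.
by lra.
Qed.

Lemma tangent_horizontal (a0 a1 : R) u v : U u -> v = a0 *: F I0 u + a1 *: F I1 u ->
  B u v dt = 0 -> v = B u v (e u) *: e u.
Proof.
move=> Uu vE vdt; have q0 := q_gt0 Uu.
have r0 : Num.sqrt (q u) != 0 by rewrite gt_eqF// sqrtr_gt0.
have tt0 : t I0 u ^+ 2 + t I1 u ^+ 2 != 0.
  have [l] := t_neq0 Uu; rewrite -/(t l u); elim/ind2: l => tl;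
    rewrite gt_eqF//.
  - by rewrite ltr_wpDr ?sqr_ge0// exprn_even_gt0.
  - by rewrite ltr_wpDl ?sqr_ge0// exprn_even_gt0.
have a_t : a0 * t I0 u + a1 * t I1 u = 0 by rewrite -vdt vE BD !BZ.
(* The pair (a0, a1) is annihilated by (t_0, t_1), hence proportional to (t_1, -t_0). Taking the
   ratio by a Euclidean projection avoids asking which t_i is nonzero. *)
pose c := Num.sqrt (q u) * (a0 * t I1 u - a1 * t I0 u) / (t I0 u ^+ 2 + t I1 u ^+ 2).
have simp (r d x y : R) : r != 0 -> d != 0 -> r * x / d * (y * r^-1) * d = x * y.
  by move=> rn0 dn0; field; rewrite rn0 dn0.
have a0E : a0 = c * e0 u.
  apply: (mulIf tt0); rewrite /c /e0 simp//.
  have := congr1 ( *%R (t I0 u)) a_t; lra.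
have a1E : a1 = c * e1 u.
  apply: (mulIf tt0); rewrite /c /e1 mulrN mulNr simp//.
  have := congr1 ( *%R (t I1 u)) a_t; lra.
have vc : v = c *: e u by rewrite vE /e scalerDr !scalerA -a0E -a1E.
by rewrite {2}vc BZ e_unit// mulr1.
Qed.

(** D_j H is tangent by parallelism and horizontal since [dt] is parallel, hence a multiple psi_j of
    [e]. Symmetry of [b] makes psi proportional to theta, and [trace_shape] fixes the factor. *)
Lemma covd_H i u : U u -> D i H u = (- (lam u * th i u)) *: e u.
Proof.
move=> Uu.
have Hdt j : B u (D j H u) dt = 0.
  have := form_cst_derivative j sH (sc_smVdt S) Uu horizontalH.
  by rewrite (sc_Ddt S)// form_0r oppr0.
have DH j : D j H u = B u (D j H u) (e u) *: e u.
  by apply: (tangent_horizontal Uu _ (Hdt j)); rewrite {1}parallelH// sum2.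
pose psi j := B u (D j H u) (e u).
have bE j k : b j k u = psi j * th k u by rewrite /b DH BZ.
pose mu := psi I0 * e0 u + psi I1 * e1 u.
have psiE j : psi j = mu * th j u.
  rewrite -[LHS]mulr1 -(e_th Uu) /mu.
  have := shape_sym j I0 Uu; have := shape_sym j I1 Uu; rewrite !bE.
  move=> /(congr1 ( *%R (e1 u))) E1 /(congr1 ( *%R (e0 u))) E0; lra.
have muE : mu = - lam u.
  have := trace_shape Uu.
  under eq_bigr do under eq_bigr do rewrite bE psiE -mulrA (mulrCA mu).
  rewrite (_ : \sum_i _ = \sum_i \sum_j G i j u * (th i u * (mu * th j u))); last first.
    by apply: eq_bigr => k _; apply: eq_bigr => j _; ring.
  rewrite cogram_th// => E1.
  have := congr1 ( *%R mu) (e_th Uu); move: E1; rewrite /lam; lra.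
by rewrite DH -/(psi i) psiE muE mulNr.
Qed.

Lemma lam_gt0 u : U u -> 0 < lam u.
Proof. by move=> Uu; rewrite addr_gt0// (sc_Bpos S)// ?horizontalH ?H_neq0. Qed.

Lemma smooth_lam : sm lam.
Proof. by apply: (sc_smD S); exact: (sc_smB S). Qed.

Lemma dd_lam i u : U u -> dd i lam u = 0.
Proof.
move=> Uu; have sHH := sc_smB S sH sH.
rewrite (sc_ddD S i sHH sHH Uu) (sc_ddB S i sH sH Uu) (BC _ (H u)).
by rewrite norm_parallel// !addr0.
Qed.

Lemma covd_e_e i u : U u -> B u (D i e u) (e u) = 0.
Proof.
move=> Uu; have := form_cst_derivative i smooth_e smooth_e Uu e_unit.
by rewrite (BC _ (e u)); lra.
Qed.

Lemma covd_e_dt i u : U u -> B u (D i e u) dt = 0.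
Proof.
move=> Uu; rewrite (form_cst_derivative i smooth_e (sc_smVdt S) Uu (k := 0)).
  by rewrite (sc_Ddt S)// form_0r oppr0.
by move=> z _; exact: e_horizontal.
Qed.

(** The commutator on H, divided by -2|H|^2. Its curvature term vanishes because H is orthogonal
    both to the frame and to [dt]. *)
Lemma codazzi_H i j u x : U u ->
  (dd i (th j) u - dd j (th i) u) * B u (e u) x
  + (th j u * B u (D i e u) x - th i u * B u (D j e u) x) = 0.
Proof.
move=> Uu; have l0 := lam_gt0 Uu.
have slt k := sc_smN S (sc_smM S smooth_lam (smooth_th k)).
have DDH k l : D k (D l H) u =
    - (lam u * dd k (th l) u) *: e u + (- (lam u * th l u)) *: D k e u.
  rewrite (sc_D_eq S k (covd_H l) Uu) (sc_DZ S k (slt l) smooth_e Uu).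
  rewrite (sc_ddN S k (sc_smM S smooth_lam (smooth_th l)) Uu).
  rewrite (sc_ddM S k smooth_lam (smooth_th l) Uu) dd_lam//.
  by rewrite mul0r add0r scaleNr.
have DDHx k l : B u (D k (D l H) u) x =
    - (lam u * dd k (th l) u) * B u (e u) x - lam u * th l u * B u (D k e u) x.
  by rewrite DDH BD BZ [X in _ + X]BZ; ring.
have := sc_comm S i j sH Uu => /(congr1 (fun v => B u v x)).
rewrite (sc_BR S)// !horizontalH// ![B u (F _ u) (H u)]BC !normalH//.
rewrite BD form_oppl !DDHx => E1.
apply: (mulfI (lt0r_neq0 l0)); move: E1; lra.
Qed.

(** Theta is closed: pairing the previous identity with [e] isolates this term, as D e is orthogonal
    to [e]. *)
Lemma dd_th_sym i j u : U u -> dd i (th j) u = dd j (th i) u.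
Proof.
move=> Uu; have := codazzi_H i j (e u) Uu.
by rewrite !covd_e_e// e_unit//; lra.
Qed.

(** The derivative of [e] along itself. *)
Let V u := e0 u *: D I0 e u + e1 u *: D I1 e u.

Lemma smooth_V : smV V.
Proof.
have sF i := sc_smVF S i.
have st i : sm (t i) by exact: (sc_smB S (sF i) (sc_smVdt S)).
have sq := smooth_sqrtq_inv; have sD i := sc_smVc S i smooth_e.
exact: (sc_smVD S (sc_smVZ S (sc_smM S (st I1) sq) (sD I0))
  (sc_smVZ S (sc_smN S (sc_smM S (st I0) sq)) (sD I1))).
Qed.

(** With theta closed, [codazzi_H] reads theta_j D_i e = theta_i D_j e; contract j with [e] and use
    theta(e) = 1. *)
Lemma covd_e i u : U u -> D i e u = th i u *: V u.
Proof.
move=> Uu; apply/eqP; rewrite -subr_eq0; apply/eqP.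
apply: (form_nondegenerate Uu) => x.
rewrite BD form_oppl BZ /V BD !BZ.
have := codazzi_H i I0 x Uu; have := codazzi_H i I1 x Uu.
rewrite (dd_th_sym i I0 Uu) (dd_th_sym i I1 Uu) !subrr !mul0r !add0r.
move=> /(congr1 ( *%R (e1 u))) E1 /(congr1 ( *%R (e0 u))) E0.
have := congr1 ( *%R (B u (D i e u) x)) (e_th Uu); lra.
Qed.

Lemma V_e u : U u -> B u (V u) (e u) = 0.
Proof. by move=> Uu; rewrite /V BD !BZ !covd_e_e// !mulr0 addr0. Qed.

Lemma V_horizontal u : U u -> B u (V u) dt = 0.
Proof. by move=> Uu; rewrite /V BD !BZ !covd_e_dt// !mulr0 addr0. Qed.

(** Closedness of theta and vanishing torsion give theta_k <V,F_l> = theta_l <V,F_k>; contracting k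
    with [e] leaves <V,F_l> = theta_l <V,e> = 0. *)
Lemma V_normal j u : U u -> B u (V u) (F j u) = 0.
Proof.
move=> Uu.
have sF k := sc_smVF S k.
have sw k l : th k u * B u (V u) (F l u) = th l u * B u (V u) (F k u).
  have := dd_th_sym k l Uu.
  rewrite (sc_ddB S k smooth_e (sF l) Uu) (sc_ddB S l smooth_e (sF k) Uu).
  by rewrite (sc_torsion S k l Uu) !covd_e// !BZ => /addIr.
have := V_e Uu; rewrite form_e.
move=> /(congr1 ( *%R (th j u))).
have := congr1 ( *%R (e0 u)) (sw I0 j); have := congr1 ( *%R (e1 u)) (sw I1 j).
have := congr1 ( *%R (B u (V u) (F j u))) (e_th Uu); lra.
Qed.

(** The commutator on [e] paired with the frame. Derivatives of theta disappear because they
    multiply V, which is normal. *)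
Lemma gauss_e i j l u : U u ->
  th j u * B u (D i V u) (F l u) - th i u * B u (D j V u) (F l u) =
  th i u * (B u (F j u) (F l u) + t j u * t l u)
  - th j u * (B u (F i u) (F l u) + t i u * t l u).
Proof.
move=> Uu.
have DDe k m' : B u (D k (D m' e) u) (F l u) = th m' u * B u (D k V u) (F l u).
  rewrite (sc_D_eq S k (covd_e m') Uu) (sc_DZ S k (smooth_th m') smooth_V Uu).
  by rewrite BD BZ V_normal// mulr0 add0r BZ.
have := sc_comm S i j smooth_e Uu => /(congr1 (fun v => B u v (F l u))).
rewrite (sc_BR S)// BD form_oppl !DDe !e_horizontal.
rewrite ![B u (F _ u) (e u)]BC -!/(th _ u) -!/(t _ u); lra.
Qed.

(** Differentiate <e,H> = 0 and insert [covd_e] and [covd_H]. *)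
Lemma V_H u : U u -> B u (V u) (H u) = lam u.
Proof.
move=> Uu.
have eH z : U z -> B z (e z) (H z) = 0.
  by move=> Uz; rewrite BC normal_e// => l; exact: normalH.
have E1 i : th i u * B u (V u) (H u) = th i u * lam u.
  rewrite -BZ -covd_e// (form_cst_derivative i smooth_e sH Uu eH).
  by rewrite covd_H// form_scaler e_unit//; ring.
have := congr1 ( *%R (e0 u)) (E1 I0); have := congr1 ( *%R (e1 u)) (E1 I1).
have := congr1 ( *%R (B u (V u) (H u))) (e_th Uu).
have := congr1 ( *%R (lam u)) (e_th Uu); lra.
Qed.

Lemma no_parallel_normal_field u : ~ U u.
Proof.
move=> Uu.
pose s i l := B u (D i (F l) u) (V u) - (B u (F i u) (F l u) + t i u * t l u).
have vE i l : B u (D i V u) (F l u) = - B u (D i (F l) u) (V u).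
  rewrite (form_cst_derivative i smooth_V (sc_smVF S l) Uu (k := 0)); first by rewrite BC.
  by move=> z Uz; exact: V_normal.
(* Since V is normal, [gauss_e] says theta_j s_il = theta_i s_jl; again j is contracted with [e]. *)
have sE i l : s i l = th i u * (e0 u * s I0 l + e1 u * s I1 l).
  have := gauss_e I0 i l Uu; have := gauss_e I1 i l Uu; rewrite !vE /s.
  move=> /(congr1 ( *%R (e1 u))) E1 /(congr1 ( *%R (e0 u))) E0.
  have := congr1 ( *%R (s i l)) (e_th Uu); rewrite /s; lra.
have trs : \sum_i \sum_l G i l u * s i l =
    e0 u * (e0 u * s I0 I0 + e1 u * s I1 I0) + e1 u * (e0 u * s I0 I1 + e1 u * s I1 I1).
  rewrite -(cogram_th (fun l => e0 u * s I0 l + e1 u * s I1 l) Uu).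
  by apply: eq_bigr => i _; apply: eq_bigr => l _; rewrite sE.
(* This is s(e,e): its first part is -<D_e V, e> = |V|^2, and the rest is |e|^2 + <e,dt>^2 = 1. *)
have see : e0 u * (e0 u * s I0 I0 + e1 u * s I1 I0)
    + e1 u * (e0 u * s I0 I1 + e1 u * s I1 I1) = B u (V u) (V u) - 1.
  have DVe i : B u (D i V u) (e u) = - (th i u * B u (V u) (V u)).
    rewrite (form_cst_derivative i smooth_V smooth_e Uu (k := 0)).
      by rewrite covd_e// form_scaler.
    by move=> z Uz; exact: V_e.
  have := DVe I0; have := DVe I1; rewrite !form_e !vE.
  move=> /(congr1 ( *%R (e1 u))) E1 /(congr1 ( *%R (e0 u))) E0.
  have E2 := congr1 ( *%R (B u (V u) (V u))) (e_th Uu).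
  have := e_unit Uu; have := e_horizontal u.
  rewrite [in X in X -> _]/e BD !BZ -!/(t _ u) => et.
  have := congr1 ( *%R (e0 u * t I0 u + e1 u * t I1 u)) et.
  rewrite [B u (e u) (e u)]form_e -!/(th _ u) !thE [B u (F I1 u) (F I0 u)]BC /s.
  by rewrite [B u (F I1 u) (F I0 u)]BC; lra.
have trV := traceH Uu (fun l => V_normal l Uu).
have T0 := sc_Gpos S (fun i => t i u) Uu.
have trg : \sum_i \sum_j G i j u * B u (F i u) (F j u) = 2.
  have [K00 K01 K10 K11] := cogram_gram Uu.
  by move: K00 K11; rewrite !sum2 (sc_GC S I1 I0 Uu) [B u (F I1 u) (F I0 u)]BC; lra.
have trE : \sum_i \sum_l G i l u * s i l = 2 * B u (H u) (V u) - 2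
    - \sum_i \sum_j G i j u * (t i u * t j u).
  by rewrite -trV -trg /s !sum2; ring.
have VH := V_H Uu.
(* The vector is horizontal, so its square is nonnegative; by [V_H] and the trace identity that
   square equals -(1 + |T|^2). *)
have W0 : 0 <= B u (V u - 2 *: H u) (V u - 2 *: H u).
  have [->|Wn0] := eqVneq (V u - 2 *: H u) 0; first by rewrite form_0l.
  apply/ltW/(sc_Bpos S Uu) => //.
  by rewrite BD form_oppl BZ V_horizontal// horizontalH// mulr0 subr0.
have sqE (v w : E) : B u (v - 2 *: w) (v - 2 *: w) =
    B u v v - 4 * B u v w + 4 * B u w w.
  rewrite BD form_oppl BZ ![B u _ (_ - _)]BC !BD !form_oppl !BZ (BC _ w v); ring.
move: T0 trE VH W0; rewrite trs see (BC _ (H u) (V u)) sqE /lam /=; lra.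
Qed.

End ParallelNormalField.
(** The tension field equals 2H only on U, so the substitution under D relies on locality
    ([sc_D_eq]); the common factor 2 is then cancelled. *)
Lemma biconservative_trace (H tau : P -> E) l u : smV H ->
  (forall z, U z -> tau z = 2 *: H z) -> U u ->
  B u (\sum_i \sum_j G i j u *: (D i (D j tau) u
         - \sum_k induced_christoffel k i j u *: D k tau u)
       - \sum_i \sum_j G i j u *: Rc u (F i u) (tau u) (F j u)) (F l u) = 0 ->
  \sum_i \sum_j G i j u * (B u (D i (D j H) u) (F l u)
      - \sum_k induced_christoffel k i j u * B u (D k H u) (F l u))
    = \sum_i \sum_j G i j u * B u (Rc u (F i u) (H u) (F j u)) (F l u).
Proof.
move=> sH tauE Uu.
have D1 V W k z : smV V -> (forall z, U z -> W z = 2 *: V z) -> U z ->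
    D k W z = 2 *: D k V z.
  move=> sV VW Uz; rewrite (sc_D_eq S k VW Uz) (sc_DZ S k (sc_smC S 2) sV Uz).
  by rewrite (sc_ddC S) scale0r add0r.
have D2 i j : D i (D j tau) u = 2 *: D i (D j H) u.
  exact: (D1 _ _ i u (sc_smVc S j sH) (fun z Uz => D1 _ _ j z sH tauE Uz) Uu).
have R2 i j : B u (Rc u (F i u) (tau u) (F j u)) (F l u) =
    2 * B u (Rc u (F i u) (H u) (F j u)) (F l u).
  by rewrite !(sc_BR S)// tauE// !BZ; ring.
rewrite BD form_oppl !sum2 !BD !BZ !BD !form_oppl !D2 ?(BD, BZ).
rewrite !(D1 H tau _ _ sH tauE Uu) !R2 !BZ => E1.
apply/eqP; rewrite -subr_eq0; apply/eqP; apply: (mulfI (_ : 2 != 0 :> R)).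
  by rewrite pnatr_eq0.
by move: E1; lra.
Qed.

End SurfaceCalculus.

(** * The calculus of a space-like immersion *)

Section FirstForm.
Context {R : realType} (f : 'rV[R]_2 -> 'rV[R]_5) (u : 'rV[R]_2).
Local Notation g := (@metric_E11xH4 R).
Local Notation F := (frame f).
Hypothesis spacelike : spacelike_at g f u.

Lemma inner_metricC x v w : inner g x v w = inner g x w v.
Proof. by rewrite !inner_metricE ipC. Qed.

Lemma first_form_sym : (first_form g f u)^T = first_form g f u.
Proof. by apply/matrixP => i j; rewrite !mxE inner_metricC. Qed.

(** A kernel vector would be null for a positive definite form. *)
Lemma det_first_form : \det (first_form g f u) != 0.
Proof.
apply/negP => /det0P[w w0 wg].
by have := spacelike w0; rewrite /inner wg mul0mx mxE ltxx.
Qed.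

Lemma first_form_unit : first_form g f u \in unitmx.
Proof. by rewrite unitmxE unitfE det_first_form. Qed.

Lemma invmx_first_form_sym i j :
  invmx (first_form g f u) i j = invmx (first_form g f u) j i.
Proof. by rewrite -[in RHS]first_form_sym -trmx_inv [in RHS]mxE. Qed.

Lemma mul_invmx_first_form i k :
  \sum_j invmx (first_form g f u) i j * inner g (f u) (F j u) (F k u) = (i == k)%:R.
Proof.
have /matrixP/(_ i k) := mulVmx first_form_unit.
by rewrite [LHS]mxE [RHS]mxE => <-; apply: eq_bigr => j _; rewrite [X in _ = _ * X]mxE.
Qed.

Lemma first_form_gt0 (w : 'I_2 -> R) i0 : w i0 != 0 ->
  0 < \sum_i \sum_j w i * w j * inner g (f u) (F i u) (F j u).
Proof.
move=> wi0; have w0 : \row_i w i != 0.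
  by apply: contra wi0 => /eqP/rowP/(_ i0); rewrite !mxE => ->.
have := spacelike w0; rewrite {1}/inner mxE; congr (_ < _).
rewrite exchange_big; apply: eq_bigr => j _; rewrite mxE mulr_suml.
apply: eq_bigr => i _; rewrite [X in X * _ * _]mxE [X in _ * X * _]mxE.
by rewrite mxE [X in _ * X]mxE mulrAC.
Qed.

(** The value at w is the first form evaluated at the vector obtained from w by raising the index.
    For w_i = <F_i, d/dt> it is |T|^2. *)
Lemma invmx_first_form_ge0 (w : 'I_2 -> R) :
  0 <= \sum_i \sum_j invmx (first_form g f u) i j * (w i * w j).
Proof.
set G := invmx _.
pose s : 'rV[R]_2 := (\row_i w i) *m G.
have -> : \sum_i \sum_j G i j * (w i * w j) = inner (first_form g f) u s s.
  have GT : G^T = G by apply/matrixP => i j; rewrite mxE -invmx_first_form_sym.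
  rewrite /inner /s trmx_mul GT -[_ *m G *m _]mulmxA mulVmx ?first_form_unit//.
  rewrite mulmx1 mulmxA mxE exchange_big; apply: eq_bigr => j _.
  rewrite [X in _ = X * _]mxE mulr_suml; apply: eq_bigr => i _.
  by rewrite [X in _ = X * _ * _]mxE [X in _ = _ * X]mxE [X in _ = _ * X]mxE; ring.
have [->|s0] := eqVneq s 0; last exact: ltW (spacelike s0).
by rewrite /inner !mul0mx mxE.
Qed.

Lemma invmx_first_formE i j : invmx (first_form g f u) i j =
  (\det (first_form g f u))^-1 * cofactor (first_form g f u) j i.
Proof. by rewrite /invmx first_form_unit mxE [X in _ * X]mxE. Qed.

End FirstForm.

(** * Smoothness of determinants and cofactors, for the inverse Gram matrix *)

Section SmoothDet.
Context {R : realType} {m : nat} (U : set 'rV[R]_m).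
Hypothesis openU : open U.

Lemma smooth_det n (A : 'rV[R]_m -> 'M[R]_n) :
  (forall i j, smooth U (fun x => A x i j)) -> smooth U (fun x => \det (A x)).
Proof.
move=> sA; apply: (smooth_sum openU) => s; apply: smoothM => //.
  exact: smooth_cst.
by apply: (smooth_prod openU) => i; exact: sA.
Qed.

Lemma smooth_cofactor n (A : 'rV[R]_m -> 'M[R]_n) i j :
  (forall k l, smooth U (fun x => A x k l)) -> smooth U (fun x => cofactor (A x) i j).
Proof.
move=> sA; apply: smoothM => //; first exact: smooth_cst.
apply: smooth_det => k l.
by apply: (eq_on_smooth openU _ (sA (lift i k) (lift j l))) => x _; rewrite !mxE.
Qed.

End SmoothDet.

Section Instance.
Context {R : realType} (U : set 'rV[R]_2) (f : 'rV[R]_2 -> 'rV[R]_5).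
Hypotheses (openU : open U) (smooth_f : smooth_on U f).
Hypothesis f_pos : forall u, U u -> 0 < f u 0 ord_max.
Hypothesis spacelike_f : forall u, U u -> spacelike_at (@metric_E11xH4 R) f u.
Local Notation g := (@metric_E11xH4 R).

Lemma smooth_inner V W : smooth_on U V -> smooth_on U W ->
  smooth U (fun u => inner g (f u) (V u) (W u)).
Proof.
move=> sV sW; apply: (eq_on_smooth openU _ (smooth_ip openU smooth_f f_pos sV sW)).
by move=> u _; rewrite inner_metricE.
Qed.

Lemma smooth_invmx_first_form i j :
  smooth U (fun u => invmx (first_form g f u) i j).
Proof.
have sg k l : smooth U (fun u => first_form g f u k l).
  apply: (eq_on_smooth openU _ (smooth_inner (smooth_frame openU smooth_f k)
    (smooth_frame openU smooth_f l))).
  by move=> u _; rewrite [RHS]mxE.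
have sdet := smooth_det openU sg.
have det0 u : U u -> \det (first_form g f u) != 0.
  by move=> Uu; exact: det_first_form (spacelike_f Uu).
apply: (eq_on_smooth openU _ (smoothM openU (smoothV openU det0 sdet)
  (smooth_cofactor openU j i sg))).
by move=> u Uu; rewrite (invmx_first_formE (spacelike_f Uu)).
Qed.

Lemma immersion_calculus :
  surface_calculus U (smooth U) (smooth_on U) pderiv (covd g f)
    (fun u => inner g (f u)) d_dt (fun u => curvature g (f u)) (frame f)
    (fun i j u => invmx (first_form g f u) i j).
Proof.
have dd c u : smooth U c -> U u -> differentiable c u.
  by move=> sc Uu; exact: smooth_differentiable sc Uu.
have sF := smooth_frame openU smooth_f.
split.
- by move=> k; exact: smooth_cst.
- by move=> c d; exact: smoothD.
- by move=> c d; exact: smoothM.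
- by move=> c; exact: smoothN.
- by move=> c; exact: smoothV.
- by move=> c; exact: smooth_sqrt.
- exact: smooth_inner.
- by move=> V W; exact: smooth_fieldD.
- by move=> c V; exact: smooth_fieldZ.
- by move=> i V; exact: smooth_covd.
- exact: sF.
- exact: smooth_cst_field.
- exact: smooth_invmx_first_form.
- by move=> i c d u; exact: eq_on_pderiv.
- by move=> i k u; exact: pderiv_cst.
- by move=> i c d u sc sd Uu; exact: (pderivD i (dd _ _ sc Uu) (dd _ _ sd Uu)).
- by move=> i c u sc Uu; exact: (pderivN i (dd _ _ sc Uu)).
- by move=> i c d u sc sd Uu; exact: (pderivM i (dd _ _ sc Uu) (dd _ _ sd Uu)).
- by move=> i V W u; exact: (eq_on_covd openU f_pos).
- by move=> i V W u; exact: (covdD openU f_pos).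
- by move=> i c V u; exact: (covdZ openU f_pos).
- by move=> i u; exact: (covd_d_dt f_pos).
- move=> i V W u sV sW Uu; rewrite !inner_metricE.
  rewrite -(pderiv_ip openU smooth_f f_pos i sV sW Uu).
  by apply: (eq_on_pderiv openU i _ Uu) => z _; rewrite inner_metricE.
- by move=> i j u; exact: (torsion_free openU smooth_f f_pos).
- move=> i j V u sV Uu; rewrite (covd_commutator openU smooth_f f_pos i j sV Uu).
  by rewrite (curvature_metric _ _ _ (f_pos Uu)).
- by move=> u v w; exact: inner_metricC.
- by move=> u v w x; rewrite !inner_metricE ipDl.
- by move=> u k v x; rewrite !inner_metricE ipZl.
- move=> u v Uu; rewrite !inner_metricE ip_d_dt => /eqP; rewrite oppr_eq0 => /eqP v0.
  by apply: ip_gt0 => //; rewrite gt_eqF// f_pos.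
- move=> u v w z x Uu; rewrite (curvature_metric _ _ _ (f_pos Uu)) !inner_metricE.
  by rewrite ipZl ip_Rm.
- by move=> i j u Uu; exact: invmx_first_form_sym.
- by move=> i k u Uu; exact: mul_invmx_first_form (spacelike_f Uu) i k.
- by move=> w u Uu; exact: invmx_first_form_ge0 (spacelike_f Uu) w.
- by move=> w i u Uu wi; exact: (first_form_gt0 (spacelike_f Uu) wi).
Qed.

End Instance.

(** * From the coordinate definitions to the abstract calculus *)

Section LocalTheorem.
Context {R : realType} (f : 'rV[R]_2 -> 'rV[R]_5).
Local Notation g := (@metric_E11xH4 R).
Local Notation D := (covd g f).
Local Notation B := (fun u => inner g (f u)).
Local Notation F := (frame f).
Local Notation G := (fun i j u => invmx (first_form g f u) i j).
Local Notation H := (mean_curvature g f).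

Lemma christoffel_first_formE (U : set 'rV[R]_2) k i j u :
  surface_calculus U (smooth U) (smooth_on U) pderiv D B d_dt
    (fun u => curvature g (f u)) F G -> U u ->
  christoffel (first_form g f) u k i j = induced_christoffel D B F G k i j u.
Proof.
move=> S Uu; rewrite -(koszul S k i j Uu) /christoffel.
have ff a b : (fun z => first_form g f z a b) = (fun z => inner g (f z) (F a z) (F b z)).
  by apply: funext => z; rewrite mxE.
by congr (_ * _); apply: eq_bigr => d _; rewrite !ff.
Qed.

Variable U : set 'rV[R]_2.
Hypotheses (openU : open U) (smooth_f : smooth_on U f).
Hypothesis f_pos : forall u, U u -> 0 < f u 0 ord_max.
Hypothesis spacelike_f : forall u, U u -> spacelike_at g f u.
Hypothesis T_neq0 : forall u, U u -> tangent_part g f u d_dt != 0.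
Hypothesis parallel_H : forall u i, U u -> normal_covd g f i H u = 0.

Lemma frame_d_dt_neq0 u : U u -> exists l, inner g (f u) (F l u) d_dt != 0.
Proof.
move=> Uu; apply/existsP; apply: contraT => /existsPn t0.
have := T_neq0 Uu; rewrite /tangent_part /trace2 big1 ?eqxx// => i _.
rewrite big1// => j _; rewrite inner_metricC.
by have := t0 i; rewrite negbK => /eqP ->; rewrite scale0r scaler0.
Qed.

Lemma covd_mean_curvature j u : U u ->
  D j H u = \sum_k (\sum_m G m k u * B u (D j H u) (F m u)) *: F k u.
Proof.
move=> Uu; rewrite -(tangentialE B F G u).
exact: (subr0_eq (parallel_H j Uu)).
Qed.

Lemma tensionE u : U u -> tension g f u = 2 *: H u.
Proof.
move=> Uu; have S := immersion_calculus openU smooth_f f_pos spacelike_f.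
rewrite -[RHS](tension_mean_curv S Uu); apply: eq_bigr => i _; apply: eq_bigr => j _.
congr (_ *: (_ - _)); apply: eq_bigr => k _.
by rewrite (christoffel_first_formE k i j S Uu).
Qed.

Lemma mean_curvature_horizontal :
  (forall u, U u -> tangent_part g f u (bitension g f u) = 0) ->
  forall u, U u -> inner g (f u) (H u) d_dt = 0.
Proof.
move=> bic; have S := immersion_calculus openU smooth_f f_pos spacelike_f.
apply: (horizontal_of_biconservative S (smooth_mean_curv S)
  (fun u l Uu => mean_curv_normal S l Uu) (fun u v Uu => mean_curv_trace S Uu)
  covd_mean_curvature frame_d_dt_neq0) => l u Uu.
apply: (biconservative_trace S (smooth_mean_curv S) tensionE Uu).
have bE : bitension g f u =
    \sum_i \sum_j G i j u *: (D i (D j (tension g f)) u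
      - \sum_k induced_christoffel D B F G k i j u *: D k (tension g f) u)
    - \sum_i \sum_j G i j u *: curvature g (f u) (F i u) (tension g f u) (F j u).
  apply: (congr2 (fun v w => v - w)); last by [].
  apply: eq_bigr => i _; apply: eq_bigr => j _.
  congr (_ *: (_ - _)); apply: eq_bigr => k _.
  by rewrite (christoffel_first_formE k i j S Uu).
rewrite -bE -(form_tangential S (bitension g f u) l Uu).
by rewrite -[tangential _ _ _ _ _]/(tangent_part g f u (bitension g f u)) bic// (form_0l S).
Qed.

End LocalTheorem.

(** If coordinate a of H is nonzero at u0, it is nonzero on an open set W around u0 by continuity.
    On W the field H never vanishes, so the calculus restricted to W satisfies
    [no_parallel_normal_field], which contradicts that u0 lies in W. *)
Lemma no_local_biconservative {R : realType} (U : set 'rV[R]_2) f :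
  let g := @metric_E11xH4 R in
  open U -> smooth_on U f -> (forall u, U u -> E11xH4 (f u)) ->
  (forall u, U u -> spacelike_at g f u) ->
  (forall u, U u -> tangent_part g f u d_dt != 0) ->
  (forall u i, U u -> normal_covd g f i (mean_curvature g f) u = 0) ->
  (forall u, U u -> tangent_part g f u (bitension g f u) = 0) ->
  forall u, U u -> mean_curvature g f u = 0.
Proof.
move=> g oU sf fp sl T0 par bic u0 Uu0; apply/rowP => a; rewrite [RHS]mxE.
apply/eqP; apply: contraT => Ha.
have S := immersion_calculus oU sf fp sl.
have sH : smooth_on U (mean_curvature g f) := smooth_mean_curv S.
pose W := [set u | U u /\ mean_curvature g f u 0 a != 0].
have WU : W `<=` U by move=> u [].
have oW : open W.
  rewrite openE => u [Uu Hu]; apply: filterI; first exact: open_nbhs_nbhs.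
  have cH := smooth_continuous (sH a) Uu.
  exact: (cvgr_neq0 _ cH Hu).
have sfW : smooth_on W f by move=> b k; exact: sub_Ck WU (sf b k).
have SW := immersion_calculus oW sfW (fun u Wu => fp u (WU u Wu))
  (fun u Wu => sl u (WU u Wu)).
have hor := mean_curvature_horizontal oU sf fp sl T0 par bic.
have Hn0 u : W u -> mean_curvature g f u != 0.
  by move=> [_]; apply: contra => /eqP ->; rewrite mxE.
suff /(_ (conj Uu0 Ha)) : ~ W u0 by [].
exact: (no_parallel_normal_field SW (smooth_mean_curv SW) (fun u l Wu => mean_curv_normal SW l Wu)
  (fun u v Wu => mean_curv_trace SW Wu)
  (fun j u Wu => covd_mean_curvature par j (WU u Wu))
  (fun u Wu => frame_d_dt_neq0 T0 (WU u Wu))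
  (fun u Wu => hor u (WU u Wu)) Hn0).
Qed.

Theorem proposition6p3 (R : realType) (M : topologicalType)
    (A : oriented_surface_atlas R M) (phi : M -> 'rV[R]_5)
    (M_nonempty : [set: M] !=set0)
    (M_connected : connected [set: M])
    (M_spacelike : spacelike_surface A phi)
    (T_neq0 : nowhere_zero_T A phi)
    (H_neq0 : nonzero_mean_curvature A phi) :
  ~ (PMCV A phi /\ biconservative A phi).
Proof.
move=> [par bic]; apply: H_neq0 => i u iu.
have [phi_pos phi_smooth phi_spacelike] := M_spacelike.
have pos z : chart_img i z -> E11xH4 (local_expr phi i z) by move=> _; exact: phi_pos.
have par_i z j : chart_img i z ->
    normal_covd (@metric_E11xH4 R) (local_expr phi i) j
      (mean_curvature (@metric_E11xH4 R) (local_expr phi i)) z = 0.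
  by move=> iz; exact: par.
exact: (no_local_biconservative (@chart_img_open _ _ A i) (phi_smooth i) pos
  (phi_spacelike i) (T_neq0 i) par_i (bic i) iu).
Qed.
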